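(* Let $\mathcal{A}=\{H_1,\dots,H_n\}$ be an arrangement of affine hyperplanes $H_i=\{v\in\mathbb{R}^d : h_i(v)=c_i\}$ in $\mathbb{R}^d$, where $c_i\in\mathbb{R}$ and $h_1,\dots,h_n$ are nonzero linear forms spanning $(\mathbb{R}^d)^*$. Let $M_\mathcal{A}\subseteq \mathbf{k}[x_1,\dots,x_n]$ be its matroid ideal and $O_\mathcal{A}\subseteq\mathbf{k}[x_1,\dots,x_n,y_1,\dots,y_n]$ its oriented matroid ideal, and let $B_\mathcal{A}$ be its bounded complex. (a) The ideal $M_\mathcal{A}$ is minimally generated by the monomials $m_x(v)$, where $v$ ranges over the vertices of $\mathcal{A}$. The bounded complex $B_\mathcal{A}$ (with vertex $v$ labeled $m_x(v)$) is an $M_\mathcal{A}$-complex; thus its cellular complex $C_\bullet(B_\mathcal{A},M_\mathcal{A})$ gives a minimal free resolution of $M_\mathcal{A}$. (b) The ideal $O_\mathcal{A}$ is minimally generated by the monomials $m_{xy}(v)$, where $v$ ranges over the vertices of $\mathcal{A}$. The bounded complex $B_\mathcal{A}$ (with vertex $v$ labeled $m_{xy}(v)$) is an $O_\mathcal{A}$-complex; thus its cellular complex $C_\bullet(B_\mathcal{A},O_\mathcal{A})$ gives a minimal free resolution of $O_\mathcal{A}$.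
   Context: Monomials: for $v\in\mathbb{R}^d$ put $m_x(v)=\prod_{i:\,h_i(v)\neq c_i}x_i$ and $m_{xy}(v)=\prod_{i:\,h_i(v)>c_i}x_i\cdot\prod_{j:\,h_j(v)<c_j}y_j$. The matroid ideal $M_\mathcal{A}$ is the ideal of $\mathbf{k}[x_1,\dots,x_n]$ ($\mathbf{k}$ a field) generated by $\{m_x(v):v\in\mathbb{R}^d\}$; the oriented matroid ideal $O_\mathcal{A}$ is the ideal of $\mathbf{k}[x_1,\dots,x_n,y_1,\dots,y_n]$ generated by $\{m_{xy}(v):v\in\mathbb{R}^d\}$. The hyperplanes partition $\mathbb{R}^d$ into relatively open convex polyhedra (cells); $v,v'$ lie in the same cell iff $m_{xy}(v)=m_{xy}(v')$. Vertices are the $0$-dimensional cells. The bounded cells form a regular CW-complex $B_\mathcal{A}$, the bounded complex. Cellular complexes: let $S$ be a polynomial ring over $\mathbf{k}$ with its fine multigrading, $I$ a monomial ideal, and $\Delta$ a regular CW-complex whose vertices are labeled by monomials generating $I$. Each nonempty cell $c$ gets the label $m_c=\mathrm{lcm}$ of the labels of the vertices in its closure; the empty cell gets $m_\emptyset=1$. Fixing orientations, $C_\bullet(\Delta,I)$ has $C_i=\bigoplus_{\dim c=i}\langle m_c\rangle$ for $i\ge -1$ (so $C_{-1}=S$), where $\langle m_c\rangle$ is the free rank-one module generated in degree $\deg m_c$, with differential $\partial=\sum_{c'\le c,\dim c'=\dim c-1}[c:c']\,p_c^{c'}$, where $p_c^{c'}:\langle m_c\rangle\to\langle m_{c'}\rangle$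 is the inclusion of ideals and $[c:c']$ the incidence number. For a monomial $m$, $\Delta_{\le m}$ is the subcomplex of cells $c$ with $m_c\mid m$. $\Delta$ is an $I$-complex if every nonempty $\Delta_{\le m}$ is acyclic over $\mathbf{k}$ and $m_c\neq m_{c'}$ whenever $c'$ is a proper face of $c$; ''$C_\bullet(\Delta,I)$ gives a minimal free resolution of $I$'' means it is exact in degrees $\ge 0$, the image of $C_0\to C_{-1}$ is $I$, and the resolution $C_{\ge 0}$ of $I$ is minimal. *)

(* Defs.v *)
From HB Require Import structures.
From mathcomp Require Import all_boot all_order all_algebra.
From mathcomp Require Import boolp classical_sets reals topology.
From mathcomp Require Import mpoly.

Set Implicit Arguments.
Unset Strict Implicit.
Unset Printing Implicit Defensive.

Import Order.TTheory GRing.Theory Num.Theory numFieldTopology.Exports.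

Local Open Scope classical_set_scope.
Local Open Scope ring_scope.

(** * Ideals *)

Definition ideal_gen (S : comNzRingType) (G : set S) : set S :=
  [set p | exists2 r : seq (S * S),
     (forall a, a \in r -> G a.2) & p = \sum_(a <- r) a.1 * a.2].

(* Minimality is that of the indexed family [g] on [V]; in particular [g] is
   then injective on [V]. *)
Definition minimally_generated (S : comNzRingType) (T : Type) (I : set S)
    (V : set T) (g : T -> S) : Prop :=
  I = ideal_gen (g @` V) /\
  forall W : set T, W `<=` V -> ideal_gen (g @` W) = I -> W = V.

(** * Cell complexes and cellular resolutions *)

(* The combinatorial data of a finite regular CW-complex with oriented cells.
   [cx_cell] is the type of nonempty cells, [cx_face c' c] says that [c'] lies
   in the closure of [c], and [cx_inc c c'] is the incidence number [c:c'],
   meaningful when [c'] is a face of [c] of codimension 1. *)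
Record cell_complex := CellComplex {
  cx_cell : finType;
  cx_dim : cx_cell -> nat;
  cx_face : rel cx_cell;
  cx_inc : cx_cell -> cx_cell -> int
}.

(* All cells, the empty one being [None]. *)
Definition acell (X : cell_complex) : finType := option (cx_cell X).

Definition adim (X : cell_complex) (c : acell X) : int :=
  if c is Some c0 then (cx_dim c0)%:Z else -1.

Definition aface (X : cell_complex) (c' c : acell X) : bool :=
  match c', c with
  | None, _ => true
  | Some _, None => false
  | Some a', Some a => cx_face a' a
  end.

(* [v:∅] = 1 for every vertex v. *)
Definition ainc (X : cell_complex) (c c' : acell X) : int :=
  match c, c' with
  | Some a, Some a' => cx_inc a a'
  | Some _, None => 1
  | None, _ => 0
  end.

Definition boundary (S : pzRingType) (X : cell_complex)
    (f : {ffun acell X -> S}) : {ffun acell X -> S} :=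
  [ffun c' => \sum_(c | aface c' c && (adim c' == adim c - 1))
                (ainc c c')%:~R * f c].

Definition exact_at (S : pzRingType) (X : cell_complex)
    (C : int -> set {ffun acell X -> S}) (i : int) : Prop :=
  [set z | C i z /\ boundary z = 0] = @boundary S X @` C (i + 1).

Definition cx_vertex (X : cell_complex) : set (cx_cell X) :=
  [set v | cx_dim v = 0%N].

(* Only the values of [lab] on vertices matter. Monomials are written
   additively, as exponent vectors; [<=]%MM is divisibility. *)
Definition cell_label (X : cell_complex) (N : nat)
    (lab : cx_cell X -> 'X_{1..N}) (c : acell X) : 'X_{1..N} :=
  if c is Some c0 then
    \big[@mlcm N/0%MM]_(v : cx_cell X | (cx_dim v == 0%N) && cx_face v c0) lab v
  else 0%MM.

(* C_i is the direct sum of the principal ideals <m_c>, c of dimension i, so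
   that the maps <m_c> -> <m_c'> of the differential are inclusions. *)
Definition cellular_chain (k : fieldType) (X : cell_complex) (N : nat)
    (lab : cx_cell X -> 'X_{1..N}) (i : int) :
    set {ffun acell X -> {mpoly k[N]}} :=
  [set f | forall c, if adim c == i
                     then ideal_gen [set 'X_[cell_label lab c]] (f c)
                     else f c = 0].

Arguments cellular_chain k {X N} lab i.

(* The augmented chains over k of the subcomplex of cells whose label
   divides m. *)
Definition sub_chain (k : fieldType) (X : cell_complex) (N : nat)
    (lab : cx_cell X -> 'X_{1..N}) (m : 'X_{1..N}) (i : int) :
    set {ffun acell X -> k} :=
  [set f | forall c, f c != 0 -> adim c = i /\ (cell_label lab c <= m)%MM].

Arguments sub_chain k {X N} lab m i.

Definition is_I_complex (k : fieldType) (X : cell_complex) (N : nat)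
    (lab : cx_cell X -> 'X_{1..N}) (I : set {mpoly k[N]}) : Prop :=
  [/\ I = ideal_gen [set 'X_[lab v] | v in @cx_vertex X],
      forall m : 'X_{1..N},
        (exists c : cx_cell X, (cell_label lab (Some c) <= m)%MM) ->
        forall i : int, exact_at (sub_chain k lab m) i
    & forall c' c : cx_cell X, cx_face c' c -> c' != c ->
        cell_label lab (Some c) <> cell_label lab (Some c')].

Definition irrelevant_ideal (k : fieldType) (N : nat) : set {mpoly k[N]} :=
  ideal_gen [set 'X_i | i in [set: 'I_N]].

Definition ideal_mul_chain (S : comNzRingType) (X : cell_complex) (J : set S)
    (C : set {ffun acell X -> S}) : set {ffun acell X -> S} :=
  [set f | exists2 r : seq (S * {ffun acell X -> S}),
     (forall p, p \in r -> J p.1 /\ C p.2)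
     & f = \sum_(p <- r) [ffun c => p.1 * p.2 c]].

Definition minimal_free_resolution (k : fieldType) (X : cell_complex) (N : nat)
    (lab : cx_cell X -> 'X_{1..N}) (I : set {mpoly k[N]}) : Prop :=
  [/\ forall i : int, 0 <= i -> exact_at (cellular_chain k lab) i,
      [set boundary f None | f in cellular_chain k lab 0] = I
    & forall i : int, 1 <= i ->
        @boundary _ X @` cellular_chain k lab i `<=`
          ideal_mul_chain (@irrelevant_ideal k N) (cellular_chain k lab (i - 1))].

(** * Affine hyperplane arrangements *)

Record arrangement (R : realType) (d n : nat) := Arrangement {
  form : 'I_n -> 'Hom('cV[R]_d, R^o);
  offset : 'I_n -> R;
  form_neq0 : forall i, form i != 0;
  form_span : <<codom form>>%VS = fullv
}.

Definition fval (R : realType) (d n : nat) (A : arrangement R d n)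
  (i : 'I_n) (v : 'cV[R]_d) : R := form A i v.

Definition sign_vec (R : realType) (d n : nat) (A : arrangement R d n)
    (v : 'cV[R]_d) : {ffun 'I_n -> option bool} :=
  [ffun i => if offset A i < fval A i v then Some true
             else if fval A i v < offset A i then Some false
             else None].

(* The cells are the nonempty sets of this form. *)
Definition cell (R : realType) (d n : nat) (A : arrangement R d n)
    (s : {ffun 'I_n -> option bool}) : set 'cV[R]_d :=
  [set v | sign_vec A v = s].

Definition cell_pt (R : realType) (d n : nat) (A : arrangement R d n)
    (s : {ffun 'I_n -> option bool}) : 'cV[R]_d :=
  xget 0 (cell A s).

(* The direction space of the affine hull: the least subspace containing all
   differences of points. *)
Definition hull_dir (R : realType) (d : nat) (D : set 'cV[R]_d) :
    {vspace 'cV[R]_d} :=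
  xget 0%VS
    [set U : {vspace 'cV[R]_d} |
       (forall v w, D v -> D w -> v - w \in U) /\
       forall U' : {vspace 'cV[R]_d},
         (forall v w, D v -> D w -> v - w \in U') -> (U <= U')%VS].

Definition cell_dim (R : realType) (d n : nat) (A : arrangement R d n)
    (s : {ffun 'I_n -> option bool}) : nat :=
  \dim (hull_dir (cell A s)).

Definition vertex (R : realType) (d n : nat) (A : arrangement R d n) :
    set 'cV[R]_d :=
  [set v | cell_dim A (sign_vec A v) = 0%N].

Definition coord_bounded (R : realType) (d : nat) (D : set 'cV[R]_d) : Prop :=
  exists M : R, forall v, D v -> forall j, `|v j 0| <= M.

Definition bounded_cell (R : realType) (d n : nat) (A : arrangement R d n) :=
  {s : {ffun 'I_n -> option bool} |
    `[< cell A s !=set0 /\ coord_bounded (cell A s) >]}.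

(* Orientations of the bounded cells: a basis of the direction space of each. *)
Definition orientation (R : realType) (d n : nat) (A : arrangement R d n)
    (o : bounded_cell A -> seq 'cV[R]_d) : Prop :=
  forall s, basis_of (hull_dir (cell A (val s))) (o s).

(* For a facet [t] of [s], the sign comparing the orientation of [s] with the
   one given by a vector pointing out of [s] through [t] followed by the
   orientation of [t]; a vector from a point of [s] to a point of [t] will do. *)
Definition incidence (R : realType) (d n : nat) (A : arrangement R d n)
    (o : bounded_cell A -> seq 'cV[R]_d) (s t : bounded_cell A) : int :=
  let u := cell_pt A (val t) - cell_pt A (val s) in
  sgz (\det (\matrix_(i < size (o s), j < size (o s))
               coord (in_tuple (o s)) j (nth 0 (u :: o t) i))).

Definition bounded_complex (R : realType) (d n : nat) (A : arrangement R d n)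
    (o : bounded_cell A -> seq 'cV[R]_d) : cell_complex :=
  @CellComplex (bounded_cell A)
    (fun s => cell_dim A (val s))
    (fun t s => `[< cell A (val t) `<=` closure (cell A (val s)) >])
    (incidence o).

(** * Matroid and oriented matroid ideals *)

Definition m_x (R : realType) (d n : nat) (A : arrangement R d n)
    (v : 'cV[R]_d) : 'X_{1..n} :=
  (\sum_(i < n | fval A i v != offset A i) U_(i))%MM.

(* x_i and y_j are the variables of index [lshift n i] and [rshift n j]. *)
Definition m_xy (R : realType) (d n : nat) (A : arrangement R d n)
    (v : 'cV[R]_d) : 'X_{1..n + n} :=
  ((\sum_(i < n | (offset A i < fval A i v)%R) U_(lshift n i)) +
   (\sum_(j < n | (fval A j v < offset A j)%R) U_(rshift n j)))%MM.

Definition matroid_ideal (k : fieldType) (R : realType) (d n : nat)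
    (A : arrangement R d n) : set {mpoly k[n]} :=
  ideal_gen [set 'X_[m_x A v] | v in [set: 'cV[R]_d]].

Definition oriented_matroid_ideal (k : fieldType) (R : realType) (d n : nat)
    (A : arrangement R d n) : set {mpoly k[n + n]} :=
  ideal_gen [set 'X_[m_xy A v] | v in [set: 'cV[R]_d]].

Arguments matroid_ideal k {R d n} A.
Arguments oriented_matroid_ideal k {R d n} A.

(* Main.v *)
Require Import Defs.
From HB Require Import structures.
From mathcomp Require Import all_boot all_order all_algebra.
From mathcomp Require Import boolp classical_sets reals topology.
From mathcomp Require Import mpoly.
From mathcomp Require Import ring lra zify.

Set Implicit Arguments.
Unset Strict Implicit.
Unset Printing Implicit Defensive.

Import Order.TTheory GRing.Theory Num.Theory numFieldTopology.Exports.

Local Open Scope classical_set_scope.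
Local Open Scope ring_scope.

(** Homogenize: the affine arrangement becomes a central one in [R^d * R] with
    the extra form [t] (the last coordinate), the empty cell becomes the origin,
    and a cell is bounded iff [t] is positive on its closed cone minus [0].

    A complex of labels dividing [m] consists of the bounded cells lying in an
    intersection of closed half-spaces; Mayer-Vietoris along the remaining
    hyperplanes reduces its acyclicity to that of the bounded faces of one closed
    cell.  More generally, for faces [w] of a closed cone [k] and a linear form
    [l] vanishing on [w], let [C(k,w,l)] be the set of faces [f] of [k] containing
    [w] with [l > 0] on [f] minus [w]; it is exact unless it is [{w}].  Indeed,
    choose a form [mu] positive on [k] minus [w] and not proportional to [l], and
    let [r] be the maximum of [mu / l] over the cells of [C(k,w,l)].  Then
    [l' = r l - mu] is nonnegative on them, and mapping [f] to its largest face
    [e] on which [l'] vanishes filters [C(k,w,l)] by the smaller complexes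
    [C(k,e,l')], which are exact by induction.

    The square of the boundary vanishes because, for [b] of codimension two in
    [c], the product of signs [c:e][e:b] is the sign at [e] of the linear form
    [u |-> det_c (c, u, b)], and exactly one intermediate cell [e] lies on each
    side of the zero set of this form.

    The resolution is then read off one monomial degree at a time. *)

(** * Based complexes and exactness of subquotients *)

Section BasedComplex.

Variables (k : fieldType) (T : finType) (D : T -> T -> k).
Implicit Types (S : {set T}) (f g : {ffun T -> k}).

Definition bd (f : {ffun T -> k}) : {ffun T -> k} :=
  [ffun c' => \sum_c D c c' * f c].

Definition supported (S : {set T}) (f : {ffun T -> k}) : Prop :=
  forall c, c \notin S -> f c = 0.

(* Exactness of the subquotient of the complex based on [S]; there is no
   grading. *)
Definition exact_on (S : {set T}) : Prop :=
  forall f, supported S f -> (forall c, c \in S -> bd f c = 0) ->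
  exists2 g, supported S g & forall c, c \in S -> bd g c = f c.

Definition square0_on (S : {set T}) : Prop :=
  forall c c'', c \in S -> c'' \in S ->
  \sum_(c' in S) D c c' * D c' c'' = 0.

Definition restrict (S : {set T}) (f : {ffun T -> k}) : {ffun T -> k} :=
  [ffun c => if c \in S then f c else 0].

Lemma restrictE S f c : c \in S -> restrict S f c = f c.
Proof. by move=> cS; rewrite ffunE cS. Qed.

Lemma restrict_supported S f : supported S (restrict S f).
Proof. by move=> c /negbTE cS; rewrite ffunE cS. Qed.

Lemma bdD f g c : bd (f + g) c = bd f c + bd g c.
Proof.
by rewrite !ffunE -big_split; apply: eq_bigr => i _; rewrite ffunE mulrDr.
Qed.

Lemma bdN f c : bd (- f) c = - bd f c.
Proof.
by rewrite !ffunE -sumrN; apply: eq_bigr => i _; rewrite ffunE mulrN.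
Qed.

Lemma bd_eq0 f (S Q : {set T}) c : supported S f -> c \in Q ->
  (forall a b, a \in S -> b \in Q -> D a b = 0) -> bd f c = 0.
Proof.
move=> fS cQ DSQ; rewrite ffunE big1 // => a _.
case: (boolP (a \in S)) => [aS|/fS ->]; last by rewrite mulr0.
by rewrite DSQ // mul0r.
Qed.

Lemma bd_restrict_bd (S : {set T}) f c : square0_on S -> supported S f ->
  c \in S -> bd (restrict S (bd f)) c = 0.
Proof.
move=> sq fS cS; rewrite ffunE.
rewrite (eq_bigr (fun b => \sum_a (if b \in S then D a b * D b c else 0) * f a));
    last first.
  move=> b _; rewrite !ffunE; case: ifP => _; last first.
    by rewrite mulr0 big1 // => a _; rewrite mul0r.
  by rewrite mulr_sumr; apply: eq_bigr => a _; rewrite mulrA (mulrC (D b c)).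
rewrite exchange_big big1 // => a _; rewrite -mulr_suml -big_mkcond.
case: (boolP (a \in S)) => [aS|/fS ->]; last by rewrite mulr0.
by rewrite /= sq ?mul0r.
Qed.

(** [S1] spans a subcomplex with quotient on [S :\: S1]. A primitive for the quotient part of a
    cycle leaves an error that is a cycle in [S1], and this has a primitive there. *)
Lemma exact_on_extension (S S1 : {set T}) : S1 \subset S -> square0_on S ->
  (forall a b, a \in S1 -> b \in S :\: S1 -> D a b = 0) ->
  exact_on S1 -> exact_on (S :\: S1) -> exact_on S.
Proof.
move=> /fintype.subsetP sS sq D0 ex1 ex2 f fS fbd.
set S2 := S :\: S1 in D0 ex2 *.
have S2S a : a \in S2 -> a \in S by case/setDP.
have S1S2 a : a \in S -> a \notin S1 -> a \in S2 by move=> *; apply/setDP.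
have f1S : supported S1 (restrict S1 f) by exact: restrict_supported.
have f2S : supported S2 (restrict S2 f) by exact: restrict_supported.
have fE : f = restrict S1 f + restrict S2 f.
  apply/ffunP => c; rewrite !ffunE.
  case: (boolP (c \in S1)) => c1; case: (boolP (c \in S2)) => c2.
  - by move: c2; rewrite inE c1.
  - by rewrite addr0.
  - by rewrite add0r.
  - by rewrite addr0 fS //; apply: contra c2 => cS; exact: S1S2.
have [g2 g2S g2E] : exists2 g, supported S2 g &
    forall c, c \in S2 -> bd g c = restrict S2 f c.
  apply: ex2 => // c cS2; have := fbd _ (S2S _ cS2).
  by rewrite {1}fE bdD (bd_eq0 f1S cS2 D0) add0r.
have g2SS : supported S g2 by move=> c cS; apply: g2S; apply: contra cS => /S2S.
pose h := f - restrict S (bd g2).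
have hS1 : supported S1 h.
  move=> c cS1; rewrite !ffunE.
  case: (boolP (c \in S)) => [cS|/fS ->]; last by rewrite subr0.
  have cS2 := S1S2 _ cS cS1; have := g2E _ cS2.
  by rewrite restrictE // ffunE => ->; rewrite subrr.
have [g1 g1S g1E] : exists2 g, supported S1 g &
    forall c, c \in S1 -> bd g c = h c.
  apply: ex1 => // c cS1; have cS := sS _ cS1.
  by rewrite bdD bdN fbd // bd_restrict_bd // subrr.
exists (g1 + g2).
  move=> c cS; rewrite ffunE g2SS // g1S ?addr0 //.
  by apply: contra cS => /sS.
move=> c cS; rewrite bdD; case: (boolP (c \in S1)) => cS1.
  by rewrite g1E // /h [LHS]addrC !ffunE cS addrC subrK.
have cS2 := S1S2 _ cS cS1.
by rewrite (bd_eq0 g1S cS2 D0) add0r g2E // restrictE.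
Qed.

(** Another case of two out of three. A cycle of the quotient has its boundary in [S1], where it is
    the boundary of some [g]; then [f - g] is a cycle in [S]. *)
Lemma exact_on_quotient (S S1 : {set T}) : S1 \subset S -> square0_on S ->
  (forall a b, a \in S1 -> b \in S :\: S1 -> D a b = 0) ->
  exact_on S -> exact_on S1 -> exact_on (S :\: S1).
Proof.
move=> /fintype.subsetP sS sq D0 ex ex1 f fQ fbd.
set Q := S :\: S1 in D0 fQ fbd *.
have QS a : a \in Q -> a \in S by case/setDP.
have S1Q a : a \in S -> a \notin S1 -> a \in Q by move=> *; apply/setDP.
have fS : supported S f by move=> c cS; apply: fQ; apply: contra cS => /QS.
have hE : restrict S1 (bd f) = restrict S (bd f).
  apply/ffunP => c; rewrite /restrict ffunE [RHS]ffunE.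
  case: (boolP (c \in S1)) => c1; first by rewrite (sS _ c1).
  case: (boolP (c \in S)) => // cS.
  by rewrite fbd // S1Q.
have [g gS1 gE] : exists2 g, supported S1 g &
    forall c, c \in S1 -> bd g c = restrict S1 (bd f) c.
  apply: ex1; first exact: restrict_supported.
  by move=> c /sS cS; rewrite hE bd_restrict_bd.
have gS : supported S g by move=> c cS; apply: gS1; apply: contra cS => /sS.
have [e eS eE] : exists2 e, supported S e &
    forall c, c \in S -> bd e c = (f - g) c.
  apply: ex; first by move=> c cS; rewrite !ffunE fS // gS // subr0.
  move=> c cS; rewrite bdD bdN.
  case: (boolP (c \in S1)) => c1.
    by rewrite gE // restrictE // subrr.
  by have cQ := S1Q _ cS c1; rewrite fbd // (bd_eq0 gS1 cQ D0) subr0.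
exists (restrict Q e); first exact: restrict_supported.
move=> c cQ; have cS := QS _ cQ.
have eq_e : restrict Q e = e - restrict S1 e.
  apply/ffunP => b; rewrite !ffunE.
  case: (boolP (b \in Q)) => bQ.
    by move: bQ; rewrite inE => /andP[/negbTE -> _]; rewrite subr0.
  case: (boolP (b \in S1)) => b1; first by rewrite subrr.
  by rewrite subr0 eS //; apply: contra bQ => bS; exact: S1Q.
rewrite eq_e bdD bdN (bd_eq0 (@restrict_supported S1 e) cQ D0) subr0 eE //.
by rewrite !ffunE (gS1 c) ?subr0 //; case/setDP: cQ.
Qed.

Lemma exact_on_pair (c0 c1 : T) : c0 != c1 -> D c0 c1 = 0 -> D c0 c0 = 0 ->
  D c1 c1 = 0 -> D c1 c0 != 0 -> exact_on [set c0; c1].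
Proof.
move=> ne D01 D00 D11 D10 f fS fbd.
have bdE g c : supported [set c0; c1] g ->
    bd g c = D c0 c * g c0 + D c1 c * g c1.
  move=> gS; rewrite ffunE (bigD1 c0) //= (bigD1 c1) 1?eq_sym //= big1 ?addr0 //.
  by move=> b /andP[b0 b1]; rewrite gS ?mulr0 // !inE negb_or b0 b1.
have f1 : f c1 = 0.
  apply/eqP; have /eqP := fbd c0 (set21 _ _).
  by rewrite bdE // D00 mul0r add0r mulf_eq0 (negbTE D10).
pose g : {ffun T -> k} := [ffun c => if c == c1 then f c0 / D c1 c0 else 0].
have gS : supported [set c0; c1] g.
  by move=> c; rewrite !inE negb_or ffunE => /andP[_ /negbTE ->].
exists g => // c; rewrite bdE // !ffunE (negbTE ne) eqxx mulr0 add0r !inE.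
case/orP => /eqP ->; first by rewrite mulrC divfK.
by rewrite D11 mul0r f1.
Qed.

Hypothesis DD0 : forall c c'', \sum_c' D c c' * D c' c'' = 0.

(** Two-step paths between members of [S] stay in [S], so the sums in [square0_on] agree with the
    full sums. *)
Definition D_convex (S : {set T}) : Prop := forall a b c, a \in S -> c \in S ->
  D c b != 0 -> D b a != 0 -> b \in S.

Lemma D_convex_square0 S : D_convex S -> square0_on S.
Proof.
move=> cvx c c'' cS c''S; rewrite -[RHS](DD0 c c'') big_mkcond.
apply: eq_bigr => b _; case: ifP => // /negbT bS; apply/esym/eqP.
by apply: contraNT bS; rewrite mulf_eq0 negb_or => /andP[]; exact: cvx.
Qed.

(** The map [phi] filters the complex, with its fibers as graded pieces. One value of maximal rank
    is split off at a time; no entry leads into its fiber from another one, so the rest is a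
    subcomplex. *)
Lemma exact_on_fibers (S : {set T}) (U : finType) (phi : T -> U)
    (rk : U -> nat) :
  D_convex S ->
  (forall a b, a \in S -> b \in S -> D a b != 0 ->
     phi b = phi a \/ (rk (phi b) < rk (phi a))%N) ->
  (forall u, u \in phi @: S -> exact_on [set c in S | phi c == u]) ->
  exact_on S.
Proof.
move=> Scvx mono fib.
suff H m (Q : {set U}) : (#|Q| <= m)%N -> Q \subset phi @: S ->
    (forall a b, a \in S -> b \in S -> D a b != 0 ->
       phi a \in Q -> phi b \in Q) ->
    exact_on [set c in S | phi c \in Q].
  have -> : S = [set c in S | phi c \in phi @: S].
    apply/setP => c; rewrite inE; case: (boolP (c \in S)) => //= cS.
    by rewrite imset_f.
  by apply: (H _ _ (leqnn _)) => // a b aS bS _ _; exact: imset_f.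
elim: m Q => [|m IH] Q.
  rewrite leqn0 cards_eq0 => /eqP -> _ _ f f0 _; exists f => // c.
  by rewrite !inE andbF.
move=> Qm QS Qdown; case: (set_0Vmem Q) => [->|[u0 u0Q]].
  by move=> f f0 _; exists f => // c; rewrite !inE andbF.
have [u uQ umax] := @arg_maxnP U u0 (fun u => u \in Q) rk u0Q.
set S' := [set c in S | phi c \in Q].
have sub : [set c in S | phi c \in Q :\ u] \subset S'.
  apply/fintype.subsetP => c; rewrite !inE => /andP[-> /andP[_ ->]] //.
have down' a b : a \in S -> b \in S -> D a b != 0 -> phi a \in Q :\ u ->
    phi b \in Q :\ u.
  move=> aS bS Dab; rewrite !inE => /andP[au aQ].
  rewrite (Qdown a b) // andbT; case: (mono a b aS bS Dab) => [->//|lt].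
  by apply: contraTneq lt => ->; rewrite -leqNgt; exact: umax.
have dif : S' :\: [set c in S | phi c \in Q :\ u] = [set c in S | phi c == u].
  apply/setP => c; rewrite !inE; case: (c \in S) => //=.
  case: eqP => [->|] /=; first by rewrite uQ.
  by rewrite andNb.
apply: (exact_on_extension sub).
- apply: D_convex_square0 => a b c; rewrite !inE.
  move=> /andP[aS aQ] /andP[cS cQ] Dcb Dba.
  have bS : b \in S by apply: (Scvx a b c).
  by rewrite bS (Qdown c b).
- move=> a b; rewrite dif !inE => /andP[aS aQ] /andP[bS /eqP bu].
  apply/eqP/negP => /negP Dab.
  by have := down' a b aS bS Dab; rewrite !inE bu eqxx /= => /(_ aQ).
- apply: IH => //.
    by rewrite -ltnS (leq_trans _ Qm) // [in X in (_ < X)%N](cardsD1 u) uQ.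
  exact: fintype.subset_trans (subD1set _ _) QS.
- by rewrite dif; apply: fib; exact: (fintype.subsetP QS).
Qed.

(** Mayer-Vietoris: the quotient of [S1 :|: S2] by [S1] is that of [S2] by [S1 :&: S2]. *)
Lemma exact_on_union (S1 S2 : {set T}) :
  (forall a b, a \in S1 -> D a b != 0 -> b \in S1) ->
  (forall a b, a \in S2 -> D a b != 0 -> b \in S2) ->
  exact_on S1 -> exact_on S2 -> exact_on (S1 :&: S2) -> exact_on (S1 :|: S2).
Proof.
move=> cl1 cl2 ex1 ex2 ex12.
have dif : (S1 :|: S2) :\: S1 = S2 :\: (S1 :&: S2).
  by apply/setP => c; rewrite !inE; case: (c \in S1); case: (c \in S2).
have D1 a b : a \in S1 -> b \notin S1 -> D a b = 0.
  by move=> a1 b1; apply/eqP; apply: contraNT b1; exact: cl1.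
apply: (@exact_on_extension _ S1) => //.
- exact: finset.subsetUl.
- apply: D_convex_square0 => a b c _; rewrite !inE => /orP[c1|c2] Dcb _.
    by rewrite (cl1 c b).
  by rewrite (cl2 c b) // orbT.
- by move=> a b a1; rewrite inE => /andP[/D1 -> //].
rewrite dif; apply: exact_on_quotient => //.
- exact: finset.subsetIr.
- by apply: D_convex_square0 => a b c _ c2 Dcb _; exact: (cl2 c b).
- by move=> a b; rewrite inE => /andP[a1 _];
  rewrite -dif inE => /andP[/D1 -> //].
Qed.

End BasedComplex.
(** * Cells of a central arrangement *)

Section Scalar.

Variables (R : pzRingType) (V : lmodType R) (l : V -> R).
Hypothesis l_lin : scalar l.

Lemma linformD x y : l (x + y) = l x + l y.
Proof. by rewrite -[x in LHS]scale1r l_lin mul1r. Qed.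

Lemma linform0 : l 0 = 0.
Proof. by apply: (@addrI _ (l 0)); rewrite -linformD !addr0. Qed.

Lemma linformZ a x : l (a *: x) = a * l x.
Proof. by rewrite -[a *: x]addr0 l_lin linform0 addr0. Qed.

Lemma linformN x : l (- x) = - l x.
Proof. by rewrite -scaleN1r linformZ mulN1r. Qed.

Lemma linformB x y : l (x - y) = l x - l y.
Proof. by rewrite linformD linformN. Qed.

End Scalar.

Lemma mul_gt0_trans (R : realFieldType) (a b c : R) :
  0 < a * b -> 0 < b * c -> 0 < a * c.
Proof.
move=> ab bc.
have : 0 < (a * c) * b ^+ 2 by have := mulr_gt0 ab bc; nra.
have b0 : 0 < b ^+ 2.
  rewrite exprn_even_gt0 //=; apply: contraTneq ab => ->.
  by rewrite mulr0 ltxx.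
by rewrite pmulr_lgt0.
Qed.

Section CentralArrangement.

Variables (R : realFieldType) (V : lmodType R) (I : finType) (g : I -> V -> R).
Hypothesis g_lin : forall i, scalar (g i).
Implicit Types (x y u w f k : V) (l : V -> R) (i : I).

(* [x] lies in the closure of the cell of [y]. *)
Definition in_closure x y : Prop := forall i, g i x = 0 \/ 0 < g i x * g i y.

Local Notation "x ⊑ y" := (in_closure x y) (at level 70).

(* [u] lies in the linear span of the cell of [x]. *)
Definition in_span x u : Prop := forall i, g i x = 0 -> g i u = 0.

(* The cell of [f], a coface of the cell of [w], spans one more dimension. *)
Definition ray_over w f : Prop :=
  forall u, in_span f u -> exists a, in_span w (u - a *: f).

Definition form_support x : {set I} := [set i | g i x != 0].

Let gD i := linformD (g_lin i).
Let gB i := linformB (g_lin i).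
Let gZ i := linformZ (g_lin i).
Let g0 i := linform0 (g_lin i).
Let gN i := linformN (g_lin i).

Lemma in_closure_refl x : x ⊑ x.
Proof.
move=> i; have [->|gx] := eqVneq (g i x) 0; first by left.
by right; rewrite -expr2 exprn_even_gt0.
Qed.

Lemma in_closure_trans y x z : x ⊑ y -> y ⊑ z -> x ⊑ z.
Proof.
move=> xy yz i; case: (xy i) => [->|p]; [by left | right].
apply: (mul_gt0_trans p); case: (yz i) => // y0.
by move: p; rewrite y0 mulr0 ltxx.
Qed.

Lemma in_closure0 x : 0 ⊑ x.
Proof. by move=> i; left; rewrite g0. Qed.

Lemma in_closure_eq0 x y i : x ⊑ y -> g i y = 0 -> g i x = 0.
Proof. by move=> /(_ i) [//|+ y0]; rewrite y0 mulr0 ltxx. Qed.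

Lemma in_closureD x y z : x ⊑ z -> y ⊑ z -> x + y ⊑ z.
Proof.
move=> xz yz i; rewrite gD; case: (xz i) (yz i) => [->|px] [->|py].
- by left; rewrite addr0.
- by right; rewrite add0r.
- by right; rewrite addr0.
- by right; rewrite mulrDl addr_gt0.
Qed.

(** Within one closed cell the nonzero values of a form have equal signs, so nothing cancels in a
    sum. *)
Lemma in_closure_Dl x y z : x ⊑ z -> y ⊑ z -> x ⊑ x + y.
Proof.
move=> xz yz i; rewrite gD mulrDr; case: (xz i) (yz i) => [->|px] [->|py].
- by left.
- by left.
- by right; rewrite mulr0 addr0; case: (in_closure_refl x i) => // x0;
    move: px; rewrite x0 mul0r ltxx.
- right; apply: addr_gt0; last first.
    by apply: (mul_gt0_trans px); rewrite mulrC.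
  by apply: (mul_gt0_trans px); rewrite mulrC.
Qed.

Lemma in_closure_scale a x : 0 < a -> a *: x ⊑ x.
Proof.
move=> a0 i; rewrite gZ.
case: (in_closure_refl x i) => [->|h]; first by left; rewrite mulr0.
by right; rewrite -mulrA mulr_gt0.
Qed.

Lemma in_closure_unscale a x : 0 < a -> x ⊑ a *: x.
Proof.
move=> a0; rewrite -{1}[x](scalerK (lt0r_neq0 a0)).
by apply: in_closure_scale; rewrite invr_gt0.
Qed.

Lemma in_closure_span x y : x ⊑ y -> in_span y x.
Proof. by move=> xy i; exact: in_closure_eq0. Qed.

Lemma in_closure_common x y z : x ⊑ z -> y ⊑ z ->
  in_span y x -> x ⊑ y.
Proof.
move=> xz yz yx i; case: (xz i) => [->|px]; [by left|right].
apply: (mul_gt0_trans px); rewrite mulrC; case: (yz i) => // /yx x0.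
by move: px; rewrite x0 mul0r ltxx.
Qed.

Lemma in_span_closure x y u : x ⊑ y -> in_span x u -> in_span y u.
Proof. by move=> xy xu i /(in_closure_eq0 xy) /xu. Qed.

Lemma in_spanZ x a u : in_span x u -> in_span x (a *: u).
Proof. by move=> xu i x0; rewrite gZ xu // mulr0. Qed.

Lemma in_span_refl x : in_span x x.
Proof. by []. Qed.

Lemma in_spanB x u v : in_span x u -> in_span x v -> in_span x (u - v).
Proof. by move=> xu xv i x0; rewrite gB xu // xv // subr0. Qed.

Lemma form_support_sub x y : x ⊑ y -> form_support x \subset form_support y.
Proof.
move=> xy; apply/fintype.subsetP => i; rewrite !inE; apply: contraNneq.
by move/(in_closure_eq0 xy) => ->.
Qed.

Lemma form_support_proper x y : x ⊑ y -> ~ y ⊑ x ->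
  form_support x \proper form_support y.
Proof.
move=> xy nyx; rewrite finset.properEneq form_support_sub // andbT.
apply/eqP => /setP eqs; apply: nyx.
apply: (in_closure_common (in_closure_refl y) xy) => i x0.
by have := eqs i; rewrite !inE x0 eqxx => /esym/negbFE/eqP.
Qed.

(** A form that is nonzero at [w] keeps its sign on both cofaces, so only the forms vanishing at [w]
    need checking. *)
Lemma sign_span x y w : w ⊑ x -> w ⊑ y ->
  (forall i, g i w = 0 -> g i x = 0 \/ 0 < g i x * g i y) -> x ⊑ y.
Proof.
move=> wx wy loc i; have [/loc//|w0] := eqVneq (g i w) 0.
right; case: (wx i) => [/eqP|]; first by rewrite (negbTE w0).
case: (wy i) => [/eqP|]; first by rewrite (negbTE w0).
by move=> p q; apply: (@mul_gt0_trans _ _ (g i w)) => //; rewrite mulrC.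
Qed.

(* Adding a large multiple of [w] fixes the signs of all the forms that do not
   vanish at [w]. *)
Lemma in_closure_shift w x y : w ⊑ x ->
  (forall i, g i w = 0 -> g i y = 0 \/ 0 < g i y * g i x) ->
  exists N, w ⊑ y + N *: w /\ y + N *: w ⊑ x.
Proof.
(* This [N] makes [N * |g i w|] exceed [|g i y|] whenever [g i w] is nonzero; the other summands are
   zero since division by 0 gives 0. *)
move=> wx loc; pose N := \sum_i `|g i y| / `|g i w| + 1.
have Nw i : g i w != 0 -> 0 < g i w * g i (y + N *: w).
  move=> w0; have nw : 0 < `|g i w| by rewrite normr_gt0.
  have bnd : `|g i y| < N * `|g i w|.
    rewrite -ltr_pdivrMr // /N (bigD1 i) //= -addrA ltrDl ltr_wpDl //.
    by rewrite sumr_ge0 // => j _; rewrite divr_ge0.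
  rewrite gD gZ mulrDr mulrCA -expr2 -[g i w ^+ 2]real_normK ?num_real //.
  have : - (`|g i w| * `|g i y|) <= g i w * g i y.
    by rewrite -normrM lerNnormlW.
  by nra.
exists N; split.
  by move=> i; have [->|/Nw] := eqVneq (g i w) 0; [left|right].
apply: (@sign_span _ _ w) => //.
  by move=> i; have [->|/Nw] := eqVneq (g i w) 0; [left|right].
by move=> i w0; rewrite gD gZ w0 mulr0 addr0; exact: loc.
Qed.

(** If the cell of [x] spans more than one dimension over [w], its span contains a direction,
    independent of [x] modulo the span of [w], along which [l] is constant. Moving along it until a
    form vanishing at [w] becomes zero gives a smaller face with the same value of [l], and the
    support drops. *)
Lemma exists_ray l w k x : scalar l -> l w = 0 -> w ⊑ k -> x ⊑ k -> 0 < l x ->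
  exists f, [/\ w ⊑ f, f ⊑ k, 0 < l f & ray_over w f].
Proof.
move=> ll lw wk xk lx.
suff H m y : w ⊑ y -> y ⊑ k -> 0 < l y -> (#|form_support y| <= m)%N ->
    exists f, [/\ w ⊑ f, f ⊑ k, 0 < l f & ray_over w f].
  apply: (H #|form_support (w + x)| (w + x)) => //.
  - exact: in_closure_Dl wk xk.
  - exact: in_closureD.
  - by rewrite (linformD ll) lw add0r.
elim: m y => [|m IH] {lx xk}x wx xk lx card_x.
  exists x; split=> // u xu; exists 0 => i _; rewrite scale0r subr0; apply: xu.
  move: card_x; rewrite leqn0 cards_eq0 => /eqP /setP /(_ i).
  by rewrite !inE => /negbFE/eqP.
have [ray|nray] := pselect (ray_over w x); first by exists x.
have [u xu nu] : exists2 u, in_span x u & forall a, ~ in_span w (u - a *: x).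
  apply: contrapT => H; apply: nray => u xu; apply: contrapT => Ha.
  by apply: H; exists u => // a wu; apply: Ha; exists a.
pose u1 := u - (l u / l x) *: x.
have lu1 : l u1 = 0 by rewrite (linformB ll) (linformZ ll) divfK ?subrr // gt_eqF.
have xu1 : in_span x u1 by apply: in_spanB => //; apply: in_spanZ.
have [i1 wi1 u1i1] : exists2 i, g i w = 0 & g i u1 != 0.
  apply: contrapT => H; apply: (nu (l u / l x)) => i wi; apply/eqP.
  by apply: contrapT => /negP ui; apply: H; exists i.
have xi1 : g i1 x != 0 by apply: contraNneq u1i1 => /xu1 ->.
(* The sign of the direction is chosen so that moving along it from [x] drives the form [i1] towards
   zero. *)
have [u2 [lu2 xu2 neg]] : exists u2, [/\ l u2 = 0, in_span x u2 &
    g i1 u2 * g i1 x < 0].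
  have := mulf_neq0 u1i1 xi1; rewrite neq_lt => /orP[neg|pos].
    by exists u1.
  exists (- u1); split; first by rewrite (linformN ll) lu1 oppr0.
    by move=> i /xu1; rewrite gN => ->; rewrite oppr0.
  by rewrite gN mulNr oppr_lt0.
pose J i := (g i w == 0) && (g i u2 * g i x < 0).
have Ji1 : J i1 by rewrite /J wi1 eqxx.
(* Among the forms vanishing at [w], [i0] is the first to reach zero. The signs of the forms nonzero
   at [w] are restored afterwards by adding a multiple of [w]. *)
have [i0 /andP[/eqP wi0 neg0] i0min] :=
  @arg_minP _ _ _ i1 J (fun i => - g i x / g i u2) Ji1.
pose t := - g i0 x / g i0 u2.
have xi0 : g i0 x != 0 by apply: contraTneq neg0 => ->; rewrite mulr0 ltxx.
have u2i0 : g i0 u2 != 0 by apply: contraTneq neg0 => ->; rewrite mul0r ltxx.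
have t0 : 0 < t.
  rewrite /t -(pmulr_lgt0 _ (_ : 0 < g i0 u2 ^+ 2)) ?exprn_even_gt0 //.
  by rewrite expr2 mulrA divfK // mulNr oppr_gt0 mulrC.
have [i gw0|N [wf fx]] := @in_closure_shift w x (x + t *: u2) wx.
  rewrite gD gZ; have [x0|x0] := eqVneq (g i x) 0.
    by left; rewrite xu2 // x0 mulr0 addr0.
  have sqx : 0 < g i x ^+ 2 by rewrite exprn_even_gt0.
  have [ge0|lt0] := leP 0 (g i u2 * g i x).
    right; rewrite mulrDl -expr2 -mulrA ltr_wpDr //.
    by rewrite mulr_ge0 // ltW.
  have u20 : g i u2 != 0 by apply: contraTneq lt0 => ->; rewrite mul0r ltxx.
  have : t <= - g i x / g i u2 by apply: i0min; rewrite /J gw0 eqxx.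
  rewrite -(ler_nM2r lt0) [in X in X <= _]mulrA divfK // mulNr -expr2 => tle.
  have : 0 <= (g i x + t * g i u2) * g i x.
    by rewrite mulrDl -expr2; move: tle; nra.
  rewrite le_eqVlt => /orP[|]; last by right.
  by rewrite eq_sym mulf_eq0 (negbTE x0) orbF => /eqP; left.
set f := _ + N *: w in wf fx.
apply: (IH f) => //.
- exact: in_closure_trans fx xk.
- by rewrite !(linformD ll) !(linformZ ll) lw lu2 !mulr0 !addr0.
rewrite -ltnS (leq_trans _ card_x) //; apply: proper_card.
rewrite properE form_support_sub //=; apply/fintype.subsetPn; exists i0.
  by rewrite inE.
by rewrite inE /f !gD !gZ wi0 mulr0 addr0 /t divfK // subrr eqxx.
Qed.

(** Modulo the span of [w], [y] is a multiple [a] of [f]. If [a] is positive, so is [l y]; otherwise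
    the signs of [y] and [f] are compatible only if [y] is zero on all forms vanishing at [w]. *)
Lemma ray_over_closure l w f y : scalar l ->
  (forall u, in_span w u -> l u = 0) -> w ⊑ f -> ray_over w f ->
  0 < l f -> y ⊑ f -> 0 < l y \/ y ⊑ w.
Proof.
move=> ll lw wf ray lf yf.
have [a wy] := ray y (in_closure_span yf).
have lyE : l y = a * l f.
  by have := lw _ wy; rewrite (linformB ll) (linformZ ll) => /subr0_eq.
have [a0|a0] := ltP 0 a; first by left; rewrite lyE mulr_gt0.
right; apply: (in_closure_common yf wf) => i w0.
have := wy i w0; rewrite gB gZ => /subr0_eq yE.
case: (yf i) => //; rewrite yE -mulrA => p.
suff : a * (g i f * g i f) <= 0 by rewrite leNgt p.
by rewrite mulr_le0_ge0 // -expr2 sqr_ge0.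
Qed.

(** Modulo the span of [w], [f'] is a multiple of [f], and a nonzero one since otherwise [f] would
    lie in the closure of [w]. *)
Lemma ray_over_eqv w w' f f' : w ⊑ w' -> w' ⊑ w -> f ⊑ f' -> f' ⊑ f ->
  w ⊑ f -> ~ f ⊑ w -> ray_over w f -> ray_over w' f'.
Proof.
move=> ww' w'w ff' f'f wf nfw ray.
have [b wb] := ray f' (in_closure_span f'f).
have b0 : b != 0.
  apply/eqP => b0; apply: nfw; apply: (in_closure_trans ff').
  apply: (in_closure_common f'f wf); move: wb.
  by rewrite b0 scale0r subr0.
move=> u /(in_span_closure f'f)/ray[a wa]; exists (a / b).
apply: (in_span_closure ww').
have -> : u - (a / b) *: f' = (u - a *: f) - (a / b) *: (f' - b *: f).
  by rewrite scalerBr scalerA divfK // opprB addrA subrK.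
by apply: in_spanB => //; apply: in_spanZ.
Qed.

(** [f] is a relative interior point of its closed cell: adding a multiple of [f], where [l]
    vanishes, pushes any vector of the span into the cell. *)
Lemma span_zero l f : scalar l -> (forall x, x ⊑ f -> 0 <= l x) -> l f = 0 ->
  forall u, in_span f u -> l u = 0.
Proof.
move=> ll ge0 lf u fu.
have half v : in_span f v -> 0 <= l v.
  move=> fv; have [i f0|N [_ vf]] :=
    @in_closure_shift f f v (in_closure_refl f); first by left; exact: fv.
  by have := ge0 _ vf; rewrite (linformD ll) (linformZ ll) lf mulr0 addr0.
apply/eqP; rewrite eq_le half // andbT -oppr_ge0 -(linformN ll); apply: half.
by move=> i /fu; rewrite (linformN (g_lin i)) => ->; rewrite oppr0.
Qed.

(** Adding a member that is not in the closure of the current one strictly enlarges the set of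
    nonvanishing forms, so the process stops. *)
Lemma exists_largest (A : V -> Prop) w : A w ->
  (forall x y, A x -> A y -> A (x + y)) ->
  (forall x y, A x -> A y -> x ⊑ x + y) ->
  exists f, [/\ A f, w ⊑ f & forall x, A x -> x ⊑ f].
Proof.
move=> Aw AD Ale.
suff H m f : (#|~: form_support f| <= m)%N -> A f -> w ⊑ f ->
    exists f, [/\ A f, w ⊑ f & forall x, A x -> x ⊑ f].
  exact: (H _ w (leqnn _) Aw (in_closure_refl w)).
have stop e : A e -> w ⊑ e -> ~ (exists2 x, A x & ~ x ⊑ e) ->
    exists f, [/\ A f, w ⊑ f & forall x, A x -> x ⊑ f].
  move=> Ae we H; exists e; split=> // x Ax; apply: contrapT => nx.
  by apply: H; exists x.
elim: m f => [|m IH] f.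
  rewrite leqn0 cards_eq0 => /eqP supp Af wf; apply: (stop f) => // -[x Ax].
  apply; have xx := in_closure_common (Ale _ _ Ax Af) _ _.
  apply: xx; first by rewrite addrC; exact: Ale.
  move=> i f0; have : i \in ~: form_support f by rewrite !inE f0 eqxx.
  by rewrite supp inE.
move=> cardf Af wf; have [[x Ax nx]|] := pselect (exists2 x, A x & ~ x ⊑ f);
  last exact: stop.
apply: (IH (f + x)); last by apply: in_closure_trans wf _; exact: Ale.
  rewrite -ltnS (leq_trans _ cardf) //; apply: proper_card.
  rewrite properC; apply: form_support_proper; first exact: Ale.
  move=> fxf; apply: nx; apply: in_closure_trans fxf.
  by rewrite addrC; exact: Ale.
exact: AD.
Qed.

(** Membership in the set C(k,w,l) of the opening overview. *)
Definition in_cone k w l f : Prop :=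
  [/\ w ⊑ f, f ⊑ k & forall y, y ⊑ f -> 0 < l y \/ y ⊑ w].

Lemma in_cone_closure k w l f f' : in_cone k w l f -> w ⊑ f' -> f' ⊑ f ->
  in_cone k w l f'.
Proof.
move=> [wf fk pos] wf' f'f; split=> //; first exact: in_closure_trans f'f fk.
by move=> y yf; apply: pos; exact: in_closure_trans yf f'f.
Qed.

Lemma in_cone_apex k w l : w ⊑ k -> in_cone k w l w.
Proof. by move=> wk; split=> //; [exact: in_closure_refl | right]. Qed.

Lemma in_cone_gt0 k w l f : in_cone k w l f -> ~ f ⊑ w -> 0 < l f.
Proof. by move=> [_ _ /(_ f (in_closure_refl f))[]]. Qed.

(** On the closed cell of [k] the factor [Num.sg (g i k) * g i x] is the absolute value of [g i x].
    With positive weights this is the form [mu] of the overview. *)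
Definition weighted (a : I -> R) w k x : R :=
  \sum_(i | g i w == 0) a i * (Num.sg (g i k) * g i x).

Lemma weighted_scalar a w k : scalar (weighted a w k).
Proof.
move=> b x y; rewrite /weighted mulr_sumr -big_split; apply: eq_bigr => i _.
by rewrite (linformD (g_lin i)) (linformZ (g_lin i)) /=; ring.
Qed.

Lemma weighted_span a w k u : in_span w u -> weighted a w k u = 0.
Proof. by move=> wu; apply: big1 => i /eqP /wu ->; rewrite !mulr0. Qed.

Lemma weighted_gt0 a w k y : (forall i, 0 < a i) -> w ⊑ k -> y ⊑ k ->
  0 < weighted a w k y \/ y ⊑ w.
Proof.
move=> a0 wk yk.
have pos i : g i y != 0 -> 0 < Num.sg (g i k) * g i y.
  move=> y0; case: (yk i) => [/eqP|p]; first by rewrite (negbTE y0).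
  have k0 : g i k != 0 by apply: contraTneq p => ->; rewrite mulr0 ltxx.
  have nk : 0 < `|g i k| by rewrite normr_gt0.
  have : 0 < (Num.sg (g i k) * g i y) * `|g i k|.
    by rewrite mulrAC -numEsg mulrC.
  by rewrite pmulr_lgt0.
have ge0 i : 0 <= a i * (Num.sg (g i k) * g i y).
  rewrite mulr_ge0 ?(ltW (a0 i)) //.
  by have [->|/pos/ltW//] := eqVneq (g i y) 0; rewrite mulr0.
have [yw|nyw] := pselect (y ⊑ w); [by right|left].
have [i w0 y0] : exists2 i, g i w = 0 & g i y != 0.
  apply: contrapT => H; apply: nyw; apply: (in_closure_common yk wk) => i w0.
  by apply/eqP/negP => /negP y0; apply: H; exists i.
rewrite /weighted (bigD1 i) /= ?w0 // ltr_pwDl //.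
  by rewrite mulr_gt0 // pos.
by rewrite sumr_ge0.
Qed.

(** If no positive weights separated [f1] and [f2], changing one weight at a time would make each
    form vanishing at [w] proportional to [l] on both points, and they would lie in the same
    cell. *)
Lemma weighted_separates w k l f1 f2 : w ⊑ f1 -> w ⊑ f2 -> f1 ⊑ k -> f2 ⊑ k ->
  0 < l f1 -> 0 < l f2 -> ~ (f1 ⊑ f2 /\ f2 ⊑ f1) ->
  exists2 a : I -> R, (forall i, 0 < a i) &
    weighted a w k f1 * l f2 <> weighted a w k f2 * l f1.
Proof.
move=> wf1 wf2 f1k f2k l1 l2 ne; apply: contrapT => H.
have {}H a : (forall i, 0 < a i) ->
    weighted a w k f1 * l f2 = weighted a w k f2 * l f1.
  by move=> a0; apply: contrapT => neq; apply: H; exists a.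
have prop i : g i w = 0 -> g i f1 * l f2 = g i f2 * l f1.
  move=> w0; have [k0|k0] := eqVneq (g i k) 0.
    by rewrite (in_closure_eq0 f1k k0) (in_closure_eq0 f2k k0) !mul0r.
  pose a j : R := 1 + (j == i)%:R.
  have aE x : weighted a w k x =
      weighted (fun=> 1) w k x + Num.sg (g i k) * g i x.
    rewrite /weighted /a; under eq_bigr do rewrite mulrDl.
    rewrite big_split /=; congr (_ + _).
    rewrite (bigD1 i) ?w0 //= eqxx mul1r big1 ?addr0 // => j /andP[_ /negbTE ->].
    by rewrite mul0r.
  have := H a; have := H (fun=> 1) (fun=> ltr01); rewrite !aE => H1.
  rewrite !mulrDl H1 => Ha; apply: (@mulfI _ (Num.sg (g i k))).
    by rewrite sgr_eq0.
  rewrite !mulrA; apply: addrI; apply: Ha => j.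
  by rewrite /a ltr_pwDl ?ltr01 // ler0n.
have eqv x y : w ⊑ x -> w ⊑ y -> 0 < l x -> 0 < l y ->
    (forall i, g i w = 0 -> g i x * l y = g i y * l x) -> x ⊑ y.
  move=> wx wy lx ly xy; apply: (@sign_span _ _ w) => // i w0.
  have [->|x0] := eqVneq (g i x) 0; [by left|right].
  rewrite -(pmulr_lgt0 _ lx) -mulrA -(xy i w0) mulrA pmulr_lgt0 //.
  by rewrite -expr2 exprn_even_gt0.
by apply: ne; split; apply: eqv => // i w0; rewrite prop.
Qed.

End CentralArrangement.
(** * Acyclicity *)

Section ConeComplex.

Variables (R : realFieldType) (V : lmodType R) (I : finType) (g : I -> V -> R).
Hypothesis g_lin : forall i, scalar (g i).

Local Notation "x ⊑ y" := (in_closure g x y) (at level 70).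
Local Notation in_span := (in_span g).
Local Notation ray_over := (ray_over g).
Local Notation form_support := (form_support g).
Local Notation in_cone := (in_cone g).

(** [T] indexes the cells of the complex, [pt] chooses a point in each and [D] is the boundary
    matrix; [Tb] is a closed set of points whose cells are all represented. *)
Variables (kk : fieldType) (T : finType) (pt : T -> V) (D : T -> T -> kk).
Variable (Tb : V -> Prop).
Hypothesis Tb_closed : forall x y, Tb x -> y ⊑ x -> Tb y.
Hypothesis pt_surj : forall x, Tb x -> exists c, x ⊑ pt c /\ pt c ⊑ x.
Hypothesis pt_inj : forall c c', pt c ⊑ pt c' -> pt c' ⊑ pt c -> c = c'.
Hypothesis DD0 : forall c c'', \sum_c' D c c' * D c' c'' = 0.
Hypothesis D_face : forall c c', D c c' != 0 -> pt c' ⊑ pt c /\ c != c'.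
Hypothesis D_ray : forall c c', pt c' ⊑ pt c -> ~ pt c ⊑ pt c' ->
  ray_over (pt c') (pt c) -> D c c' != 0.

Let le_trans' := @in_closure_trans R V I g.
Let le_refl' := in_closure_refl g.

Definition cone_cells k w l : {set T} :=
  [set c | `[< in_cone k w l (pt c) >]].

Lemma cone_cellsP k w l c : reflect (in_cone k w l (pt c)) (c \in cone_cells k w l).
Proof. by rewrite inE; exact: asboolP. Qed.

Lemma cone_cells_convex k w l : D_convex D (cone_cells k w l).
Proof.
move=> a b c /cone_cellsP[wa _ _] /cone_cellsP cc /D_face[bc _] /D_face[ab _].
by apply/cone_cellsP; apply: (in_cone_closure cc) => //; exact: le_trans' ab.
Qed.

(** The complex consists of [w] and a single other cell. A cell one dimension above [w] exists in
    the cone, so it is this one, and the entry joining the two is nonzero. *)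
Lemma cone_exact_two k w l f : scalar l -> (forall u, in_span w u -> l u = 0) ->
  (forall f, in_cone k w l f -> Tb f) -> in_cone k w l f -> ~ f ⊑ w ->
  (forall f1 f2, in_cone k w l f1 -> in_cone k w l f2 -> ~ f1 ⊑ w ->
     ~ f2 ⊑ w -> f1 ⊑ f2 /\ f2 ⊑ f1) ->
  exact_on D (cone_cells k w l).
Proof.
move=> ll lw cTb cf nf two; have [wf fk _] := cf.
have wk := le_trans' wf fk.
have [f1 [wf1 f1f lf1 ray]] := exists_ray g_lin ll (lw w (@in_span_refl _ _ _ _ w))
  wf (le_refl' f) (in_cone_gt0 cf nf).
have cf1 := in_cone_closure cf wf1 f1f.
have nf1 : ~ f1 ⊑ w.
  by move=> /in_closure_span/lw l0; rewrite l0 ltxx in lf1.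
have [c0 [wc0 c0w]] := pt_surj (cTb _ (in_cone_apex l wk)).
have [c1 [fc1 c1f]] := pt_surj (cTb _ cf1).
have c10 : ~ pt c1 ⊑ pt c0 by move=> h; apply: nf1;
  exact: le_trans' fc1 (le_trans' h c0w).
have c01 : pt c0 ⊑ pt c1 by exact: le_trans' c0w (le_trans' wf1 fc1).
have -> : cone_cells k w l = [set c0; c1]%SET.
  apply/setP => c; rewrite !inE; apply/asboolP/idP => [cc|].
    have [cw|ncw] := pselect (pt c ⊑ w).
      apply/orP; left; apply/eqP/pt_inj; first exact: le_trans' cw wc0.
      by apply: le_trans' c0w _; case: cc.
    have [ccf fcc] := two _ _ cc cf1 ncw nf1.
    apply/orP; right; apply/eqP/pt_inj; first exact: le_trans' ccf fc1.
    exact: le_trans' c1f fcc.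
  case/orP => /eqP ->.
    exact: (in_cone_closure (in_cone_apex l wk)).
  by apply: (in_cone_closure cf1) => //; exact: le_trans' wf1 fc1.
have D0 c c' : ~ pt c' ⊑ pt c -> D c c' = 0.
  by move=> h; apply/eqP/negP => /negP /D_face[].
have Dcc c : D c c = 0.
  by apply/eqP/negP => /negP /D_face[_]; rewrite eqxx.
apply: exact_on_pair => //; [|exact: D0|].
  by apply/eqP => e; apply: c10; rewrite e.
by apply: D_ray => //; apply: ray_over_eqv ray.
Qed.

(** Induction on the number of cells, along the filtration by largest zero faces of [l']. *)
Theorem cone_exact k w l : scalar l -> (forall u, in_span w u -> l u = 0) ->
  (forall f, in_cone k w l f -> Tb f) ->
  (exists2 f, in_cone k w l f & ~ f ⊑ w) ->
  exact_on D (cone_cells k w l).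
Proof.
move: {2}#|_| (leqnn #|cone_cells k w l|) => m.
elim: m k w l => [|m IH] k w l card_m ll lw cTb [f cf nf]; have [wf fk _] := cf;
    have wk := le_trans' wf fk;
    have [c0 [wc0 c0w]] := pt_surj (cTb _ (in_cone_apex l wk));
    have c0S : c0 \in cone_cells k w l
      by apply/cone_cellsP; exact: (in_cone_closure (in_cone_apex l wk)).
  by move: card_m; rewrite leqn0 cards_eq0 => /eqP E; move: c0S;
    rewrite E finset.in_set0.
have [two|] := pselect (forall f1 f2, in_cone k w l f1 -> in_cone k w l f2 ->
  ~ f1 ⊑ w -> ~ f2 ⊑ w -> f1 ⊑ f2 /\ f2 ⊑ f1);
    first exact: (cone_exact_two ll lw cTb cf nf two).
move=> /existsNP[f1 /existsNP[f2]] /not_implyP[cf1 /not_implyP[cf2]].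
move=> /not_implyP[nf1 /not_implyP[nf2 ne]].
have l1 := in_cone_gt0 cf1 nf1; have l2 := in_cone_gt0 cf2 nf2.
have [wf1 f1k _] := cf1; have [wf2 f2k _] := cf2.
have [a a0 sep] := weighted_separates wf1 wf2 f1k f2k l1 l2 ne.
pose mu := weighted g a w k.
have mul : scalar mu by exact: weighted_scalar.
have muw u : in_span w u -> mu u = 0 by exact: weighted_span.
have mu0 y : y ⊑ k -> 0 < mu y \/ y ⊑ w by exact: weighted_gt0.
have lw0 : l w = 0 by apply: lw.
(* Maximizing [mu / l] over the cells one dimension above [w] suffices: if [l'] were negative
   somewhere on the cone, it would be negative on one of these. *)
pose Q c := `[< [/\ in_cone k w l (pt c), ~ pt c ⊑ w & ray_over w (pt c)] >].
have rayQ f' : in_cone k w l f' -> ~ f' ⊑ w -> ray_over w f' ->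
    exists c, [/\ f' ⊑ pt c, pt c ⊑ f' & Q c].
  move=> cf' nf' ray; have [c [fc ccf]] := pt_surj (cTb _ cf').
  have [wf' _ _] := cf'.
  exists c; split=> //; apply/asboolP; split.
  - by apply: (in_cone_closure cf') => //; exact: le_trans' fc.
  - by move=> /(le_trans' fc).
  - exact: ray_over_eqv ray.
have [cr Qcr] : exists c, Q c.
  have [f' [wf' f'f lf' ray]] := exists_ray g_lin ll lw0 wf (le_refl' f)
    (in_cone_gt0 cf nf).
  have [||//|c []] := rayQ f'; last by exists c.
    exact: in_cone_closure cf wf' f'f.
  by move=> /in_closure_span/lw l0; rewrite l0 ltxx in lf'.
have [c1 /asboolP[cc1 nc1 _] c1max] :=
  @arg_maxP _ _ _ cr Q (fun c => mu (pt c) / l (pt c)) Qcr.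
have lc1 := in_cone_gt0 cc1 nc1.
pose r := mu (pt c1) / l (pt c1).
have r0 : 0 < r.
  by rewrite divr_gt0 //; case: (mu0 (pt c1)) => //; case: cc1.
pose l' x := r * l x - mu x.
have l'l : scalar l' by move=> b x y; rewrite /l' ll mul; ring.
have l'w u : in_span w u -> l' u = 0.
  by move=> wu; rewrite /l' lw // muw // mulr0 subr0.
have l'c1 : l' (pt c1) = 0 by rewrite /l' /r divfK ?subrr // gt_eqF.
have l'_l y : y ⊑ k -> 0 < l' y -> 0 < l y.
  move=> yk; rewrite /l' subr_gt0 => lt; rewrite -(pmulr_rgt0 _ r0).
  apply: le_lt_trans lt; case: (mu0 y yk) => [/ltW//|/in_closure_span/muw ->//].
have l'_cone f' : in_cone k w l f' -> 0 <= l' f'.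
  move=> cf'; rewrite leNgt; apply/negP => lt0.
  pose n x := - l' x.
  have nl : scalar n by move=> b x y; rewrite /n l'l; ring.
  have [||||f3 [wf3 f3f nf3 ray]] := @exists_ray _ _ _ _ g_lin n w f' f' nl.
  - by rewrite /n l'w ?oppr0.
  - by case: cf'.
  - exact: le_refl'.
  - by rewrite /n oppr_gt0.
  have nf3w : ~ f3 ⊑ w.
    by move=> /in_closure_span/l'w l0; rewrite /n l0 oppr0 ltxx in nf3.
  have [c3 [f3c c3f /[dup] Q3 /asboolP[cc3 nc3 _]]] :=
    rayQ f3 (in_cone_closure cf' wf3 f3f) nf3w ray.
  have : mu (pt c3) / l (pt c3) <= r by exact: (c1max _ Q3).
  rewrite ler_pdivrMr ?(in_cone_gt0 cc3) //.
  rewrite -subr_ge0 -/(l' _) leNgt => /negP; apply.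
  have [||//] := @ray_over_closure _ _ _ _ g_lin n w f3 (pt c3) nl _ wf3 ray nf3 c3f.
    by move=> u /l'w; rewrite /n => ->; rewrite oppr0.
  by rewrite /n oppr_gt0.
(* A face of [f'] need not contain [w]; adding [w] remedies this and leaves [l'] unchanged. *)
have l'_ge0 f' x : in_cone k w l f' -> x ⊑ f' -> 0 <= l' x.
  move=> cf' xf'; have [wf' _ _] := cf'.
  have := l'_cone (w + x); rewrite (linformD l'l) l'w // add0r; apply.
  apply: (in_cone_closure cf'); first exact: in_closure_Dl wf' xf'.
  exact: in_closureD.
(* [phi c] is the largest face of [c] on which [l'] vanishes. It exists because the zeros of [l'] in
   a closed cell are closed under addition. *)
have /choice[phi phiP] : forall c, exists c', in_cone k w l (pt c) ->
    [/\ w ⊑ pt c', pt c' ⊑ pt c, l' (pt c') = 0 &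
        forall x, x ⊑ pt c -> l' x = 0 -> x ⊑ pt c'].
  move=> c.
  have [cc|] := pselect (in_cone k w l (pt c)); last by exists c.
  have [wc _ _] := cc.
  have [|x y [xc x0] [yc y0]|x y [xc _] [yc _]|e [[ec e0] we emax]] :=
    @exists_largest _ _ _ g (fun x => x ⊑ pt c /\ l' x = 0) w.
  - by split=> //; exact: l'w.
  - by split; [exact: in_closureD | rewrite (linformD l'l) x0 y0 addr0].
  - exact: in_closure_Dl xc yc.
  have [c' [ec' c'e]] := pt_surj (Tb_closed (cTb _ cc) ec).
  exists c' => _; split.
  - exact: le_trans' we ec'.
  - exact: le_trans' c'e ec.
  - apply: (span_zero g_lin l'l _ e0); last exact: in_closure_span.
    by move=> x xe; apply: (l'_ge0 _ _ cc); exact: le_trans' ec.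
  - by move=> x xc x0; apply: le_trans' ec'; apply: emax.
(* Since [mu] is nonnegative on [k], positivity of [l'] implies that of [l], and C(k,u,l') is part
   of C(k,w,l). *)
have sub u f' : in_cone k w l (pt u) -> l' (pt u) = 0 ->
    in_cone k (pt u) l' f' -> in_cone k w l f'.
  move=> [wu _ cu] u0 [uf' f'k pos]; split=> //; first exact: le_trans' uf'.
  move=> y yf'; case: (pos y yf') => [l'y|/cu//]; left.
  by apply: l'_l => //; exact: le_trans' f'k.
have phi_cone c : in_cone k w l (pt c) -> in_cone k w l (pt (phi c)).
  by move=> cc; have [? ? _ _] := phiP _ cc; apply: (in_cone_closure cc).
apply: (exact_on_fibers DD0 (phi := phi) (rk :=
  fun u => #|form_support (pt u)|)).
- exact: cone_cells_convex.
- move=> c b /cone_cellsP cc /cone_cellsP cb /D_face[bc _].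
  have [wpb pbb pb0 pbmax] := phiP _ cb; have [wpc pcc pc0 pcmax] := phiP _ cc.
  have pbpc : pt (phi b) ⊑ pt (phi c) by apply: pcmax => //;
    exact: le_trans' bc.
  have [pcpb|npcpb] := pselect (pt (phi c) ⊑ pt (phi b)).
    by left; apply: pt_inj.
  by right; apply: proper_card; exact: form_support_proper.
move=> u /imsetP[cu /cone_cellsP ccu uE].
have [wpu puu pu0 pumax] := phiP _ ccu; rewrite -uE in wpu puu pu0 pumax.
have cu' : in_cone k w l (pt u) by rewrite uE; exact: phi_cone.
have uk : pt u ⊑ k by case: cu'.
(* As [l'] is nonnegative, the cells with largest zero face [u] are those on which [l'] is positive
   off [u]. *)
have -> : [set c in cone_cells k w l | phi c == u] = cone_cells k (pt u) l'.
  apply/setP => c; rewrite [LHS]inE; apply/andP/cone_cellsP.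
    move=> [/cone_cellsP cc /eqP pc]; have [wpc pcc pc0 pcmax] := phiP _ cc.
    rewrite pc in wpc pcc pc0 pcmax.
    split=> //; first by case: cc.
    move=> y yc; have := l'_ge0 _ _ cc yc; rewrite le_eqVlt => /orP[/eqP y0|].
      by right; apply: pcmax.
    by left.
  move=> cc'; have cc := sub _ _ cu' pu0 cc'.
  split; first exact/cone_cellsP.
  have [wpc pcc pc0 pcmax] := phiP _ cc; have [uc _ pos] := cc'.
  apply/eqP/pt_inj; last by apply: pcmax.
  by case: (pos _ pcc) => //; rewrite pc0 ltxx.
have spanu v : in_span (pt u) v -> l' v = 0.
  by apply: (span_zero g_lin l'l) => // x; exact: l'_ge0.
apply: IH => //.
(* The fiber is a proper subset: it omits [c1], where [l'] vanishes, if [u] is [w], and the cell of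
   [w] otherwise. *)
- rewrite -ltnS (leq_trans _ card_m) //; apply: proper_card.
  rewrite properE; apply/andP; split.
    by apply/fintype.subsetP => c /cone_cellsP/(sub _ _ cu' pu0) cc;
      apply/cone_cellsP.
  apply/fintype.subsetPn.
  have [uw|nuw] := pselect (pt u ⊑ w).
    exists c1; first exact/cone_cellsP.
    apply/negP => /cone_cellsP[_ _ /(_ _ (le_refl' _))[]].
      by rewrite l'c1 ltxx.
    by move=> c1u; apply: nc1; exact: le_trans' uw.
  exists c0 => //; apply/negP => /cone_cellsP[uc0 _ _].
  by apply: nuw; exact: le_trans' uc0 c0w.
- by move=> f' /(sub _ _ cu' pu0)/cTb.
(* If [l'] vanished at both [f1] and [f2], [mu] would be proportional to [l] there, against the
   choice of the weights. *)
have [x xk lx] : exists2 x, x ⊑ k & 0 < l' x.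
  have [le0|] := ltP 0 (l' f1); first by exists f1.
  have [le0|] := ltP 0 (l' f2); first by exists f2.
  move=> le2 le1; case: sep.
  have e1 : l' f1 = 0 by apply/eqP; rewrite eq_le le1 l'_cone.
  have e2 : l' f2 = 0 by apply/eqP; rewrite eq_le le2 l'_cone.
  move: e1 e2; rewrite /l' => /subr0_eq e1 /subr0_eq e2.
  by rewrite -/mu -e1 -e2; ring.
have [f' [uf' f'k lf' ray]] := exists_ray g_lin l'l pu0 uk xk lx.
exists f'; last by move=> /in_closure_span/spanu l0; rewrite l0 ltxx in lf'.
by split=> // y yf'; exact: (ray_over_closure g_lin l'l spanu uf' ray lf' yf').
Qed.

(** * Bounded cells in an intersection of closed half-spaces *)

Variable t : V -> R.
Hypothesis t_lin : scalar t.
Hypothesis t_span0 : forall u, in_span 0 u -> t u = 0.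
Hypothesis TbE : forall x, Tb x <-> forall y, y ⊑ x -> 0 < t y \/ y ⊑ 0.
Hypothesis pt_Tb : forall c, Tb (pt c).

(** An index in both sets confines [x] to the hyperplane; an index in neither leaves it free. *)
Definition in_poly (Ap Am : {set I}) (x : V) : Prop :=
  forall i, (i \in Ap -> 0 <= g i x) /\ (i \in Am -> g i x <= 0).

Definition poly_cells Ap Am : {set T} := [set c | `[< in_poly Ap Am (pt c) >]].

Lemma poly_cellsP Ap Am c :
  reflect (in_poly Ap Am (pt c)) (c \in poly_cells Ap Am).
Proof. by rewrite inE; exact: asboolP. Qed.

Lemma in_poly_closure Ap Am x y : in_poly Ap Am y -> x ⊑ y -> in_poly Ap Am x.
Proof.
move=> yP xy i; have [yp ym] := yP i; split=> [/yp|/ym] y0.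
  have [->//|x0] := xy i; rewrite leNgt; apply/negP => xl0.
  by have : g i x * g i y <= 0 by [rewrite mulr_le0_ge0 // ltW];
    rewrite leNgt x0.
have [->//|x0] := xy i; rewrite leNgt; apply/negP => xl0.
by have : g i x * g i y <= 0 by [rewrite mulr_ge0_le0 // ltW]; rewrite leNgt x0.
Qed.

Lemma in_polyD Ap Am x y : in_poly Ap Am x -> in_poly Ap Am y ->
  in_poly Ap Am (x + y).
Proof.
move=> xP yP i; have [xp xm] := xP i; have [yp ym] := yP i.
rewrite (linformD (g_lin i)); split=> iA; first by rewrite addr_ge0 ?xp ?yp.
by rewrite -oppr_ge0 opprD addr_ge0 // oppr_ge0 ?xm ?ym.
Qed.

Lemma in_polyZ Ap Am a x : 0 <= a -> in_poly Ap Am x -> in_poly Ap Am (a *: x).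
Proof.
move=> a0 xP i; have [xp xm] := xP i.
rewrite (linformZ (g_lin i)); split=> iA; first by rewrite mulr_ge0 ?xp.
by rewrite mulr_ge0_le0 ?xm.
Qed.

Lemma poly_cells_closed Ap Am a b : a \in poly_cells Ap Am -> D a b != 0 ->
  b \in poly_cells Ap Am.
Proof.
move=> /poly_cellsP aP /D_face[ba _]; apply/poly_cellsP.
exact: in_poly_closure ba.
Qed.

(** The cell of [x] may be unbounded, but an extremal ray in its closure with [t] positive belongs
    to [Tb]. *)
Lemma poly_cell_exists Ap Am x : in_poly Ap Am x -> 0 < t x ->
  exists2 c, c \in poly_cells Ap Am & ~ pt c ⊑ 0.
Proof.
move=> xP tx.
have [f [f0 fx tf ray]] := exists_ray g_lin t_lin (linform0 t_lin)
  (in_closure0 g_lin x) (le_refl' x) tx.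
have [|c [fc cf]] := pt_surj (_ : Tb f).
  by apply/TbE => y yf; exact: (ray_over_closure g_lin t_lin t_span0 f0 ray tf yf).
exists c; first by apply/poly_cellsP; apply: (in_poly_closure xP);
  exact: le_trans' fx.
move=> c0; have /in_closure_span/t_span0 t0 := le_trans' fc c0.
by rewrite t0 ltxx in tf.
Qed.

(** Induction on the number of forms that do not yet constrain the polyhedron. When none is left it
    is a single closed cell; otherwise it is cut along a free hyperplane and Mayer-Vietoris
    applies. *)
Theorem poly_exact Ap Am :
  (exists2 c, c \in poly_cells Ap Am & ~ pt c ⊑ 0) ->
  exact_on D (poly_cells Ap Am).
Proof.
move: {2}#|_| (leqnn #|~: (Ap :|: Am)|) => m.
elim: m Ap Am => [|m IH] Ap Am card_m [c cP nc0].
  have cover i : (i \in Ap) || (i \in Am).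
    apply/negP => /negP ni; move: card_m;
      rewrite leqn0 cards_eq0 => /eqP/setP/(_ i).
    by rewrite !inE ni.
  (* Every form has a constant sign on the polyhedron, so sums do not cancel and there is a largest
     cell [k]. The complex is then C(k,0,t). *)
  have [i|x y|x y xP yP i|k [kP _ kmax]] :=
    @exists_largest _ _ _ g (in_poly Ap Am) 0.
  - by rewrite (linform0 (g_lin i)).
  - exact: in_polyD.
  - have [xp xm] := xP i; have [yp ym] := yP i; rewrite (linformD (g_lin i)).
    have [->|x0] := eqVneq (g i x) 0; [by left|right].
    rewrite mulrDr ltr_pwDl //; first by rewrite -expr2 exprn_even_gt0.
    case/orP: (cover i) => iA; first by rewrite mulr_ge0 ?xp ?yp.
    by rewrite mulr_le0 ?xm ?ym.
  have -> : poly_cells Ap Am = cone_cells k 0 t.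
    apply/setP => a; apply/poly_cellsP/cone_cellsP => [aP|[_ ak _]].
      split; [exact: in_closure0 | exact: kmax |].
      exact: (iffLR (TbE _) (pt_Tb a)).
    exact: in_poly_closure ak.
  apply: cone_exact => //.
    by move=> f [_ _ pos]; apply/TbE.
  exists (pt c) => //; split; [exact: in_closure0 | exact/kmax/poly_cellsP |].
  exact: (iffLR (TbE _) (pt_Tb c)).
case: (set_0Vmem (~: (Ap :|: Am))) => [E|[i0]].
  by apply: IH; [rewrite E cards0 | exists c].
rewrite !inE negb_or => /andP[i0p i0m].
pose Ap' := i0 |: Ap; pose Am' := i0 |: Am.
have pE x : in_poly Ap' Am x <-> in_poly Ap Am x /\ 0 <= g i0 x.
  split=> [xP|[xP x0] i].
    split=> [i|]; last by case: (xP i0) => h _; apply: h; rewrite !inE eqxx.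
    by have [xp xm] := xP i; split=> // ip; apply: xp; rewrite !inE ip orbT.
  have [xp xm] := xP i; split=> //; rewrite !inE => /orP[/eqP -> //|].
  exact: xp.
have mE B x : in_poly B Am' x <-> in_poly B Am x /\ g i0 x <= 0.
  split=> [xP|[xP x0] i].
    split=> [i|]; last by case: (xP i0) => _ h; apply: h; rewrite !inE eqxx.
    by have [xp xm] := xP i; split=> // ip; apply: xm; rewrite !inE ip orbT.
  have [xp xm] := xP i; split=> //; rewrite !inE => /orP[/eqP -> //|].
  exact: xm.
have card B C : i0 \in B :|: C -> Ap \subset B -> Am \subset C ->
    (#|~: (B :|: C)| <= m)%N.
  move=> i0B AB AC; rewrite -ltnS (leq_trans _ card_m) //; apply: proper_card.
  rewrite properC properE finset.setUSS //=; apply/fintype.subsetPn;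
    exists i0 => //.
  by rewrite inE negb_or i0p.
have cp : (#|~: (Ap' :|: Am)| <= m)%N.
  by apply: card; rewrite ?finset.subsetU1 // !inE eqxx.
have cm : (#|~: (Ap :|: Am')| <= m)%N.
  by apply: card; rewrite ?finset.subsetU1 // !inE eqxx !orbT.
have c0 : (#|~: (Ap' :|: Am')| <= m)%N.
  by apply: card; rewrite ?finset.subsetU1 // !inE eqxx.
have UE : poly_cells Ap Am = poly_cells Ap' Am :|: poly_cells Ap Am'.
  apply/setP => a; rewrite [RHS]inE; apply/poly_cellsP/orP.
    move=> aP; case: (lerP 0 (g i0 (pt a))) => a0; [left|right].
      by apply/poly_cellsP/pE.
    by apply/poly_cellsP/mE; split=> //; exact: ltW.
  by case=> /poly_cellsP => [/pE[]|/mE[]].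
have IE : poly_cells Ap' Am :&: poly_cells Ap Am' = poly_cells Ap' Am'.
  apply/setP => a; rewrite [LHS]inE; apply/andP/poly_cellsP.
    by move=> [/poly_cellsP aP /poly_cellsP/mE[_ a0]]; apply/mE.
  move=> /mE[/[dup] /pE[aP _] aP' a0].
  by split; apply/poly_cellsP => //; apply/mE.
have t_gt0 a : ~ pt a ⊑ 0 -> 0 < t (pt a).
  by move=> na; case: (iffLR (TbE _) (pt_Tb a) _ (le_refl' _)).
(* If one half has no cell but the origin, the other half is the whole complex. *)
have one A1 A2 A1' A2' : (#|~: (A1 :|: A2)| <= m)%N ->
    poly_cells Ap Am = poly_cells A1 A2 :|: poly_cells A1' A2' ->
    ~ (exists2 c, c \in poly_cells A1' A2' & ~ pt c ⊑ 0) ->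
    exact_on D (poly_cells Ap Am).
  move=> cA E no.
  have E1 : poly_cells Ap Am = poly_cells A1 A2.
    rewrite E; apply/finset.setUidPl/fintype.subsetP => a aP;
      apply/poly_cellsP => i.
    have a0 : pt a ⊑ 0 by apply: contrapT => na; apply: no; exists a.
    by rewrite (in_closure_eq0 a0) ?(linform0 (g_lin i)).
  by rewrite E1; apply: IH => //; exists c; rewrite -?E1.
have [[a aP na]|no] := pselect (exists2 c, c \in poly_cells Ap' Am & ~ pt c ⊑ 0);
    last by apply: one no; [exact: cm | rewrite UE finset.setUC].
have [[b bP nb]|no] := pselect (exists2 c, c \in poly_cells Ap Am' & ~ pt c ⊑ 0);
    last exact: one UE no.
rewrite UE; apply: exact_on_union => //.
- exact: poly_cells_closed.
- exact: poly_cells_closed.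
- by apply: IH => //; exists a.
- by apply: IH => //; exists b.
rewrite IE; apply: IH => //.
move: aP bP => /poly_cellsP/pE[aP a0] /poly_cellsP/mE[bP b0].
have ta := t_gt0 _ na; have tb := t_gt0 _ nb.
have [a1|a1] := eqVneq (g i0 (pt a)) 0.
  apply: (@poly_cell_exists _ _ (pt a)) => //; apply/mE; split;
    last by rewrite a1.
  exact/pE.
(* [z] lies on the hyperplane between [a] and [b] with [t] positive, so the common wall also carries
   a cell other than the origin. *)
pose z := (- g i0 (pt b)) *: pt a + g i0 (pt a) *: pt b.
have z0 : g i0 z = 0.
  by rewrite (linformD (g_lin i0)) !(linformZ (g_lin i0)); ring.
apply: (@poly_cell_exists _ _ z).
  apply/mE; rewrite z0; split=> //; apply/pE; rewrite z0; split=> //.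
  by apply: in_polyD; apply: in_polyZ => //; rewrite oppr_ge0.
rewrite (linformD t_lin) !(linformZ t_lin) ltr_wpDl //.
  by rewrite mulr_ge0 ?oppr_ge0 // ltW.
by rewrite mulr_gt0 // lt_neqAle eq_sym a1.
Qed.

End ConeComplex.
(** * Incidence signs *)

Section FrameDet.

Variables (F : fieldType) (V : vectType F).
Implicit Types (e y z : seq V) (x u : V).

(** The coordinates of [y] in the frame [e] are meaningful when [y] lies in its span. Reading rows
    with [nth 0] avoids a constraint on the length of [y]. *)
Definition frame_det e y : F :=
  \det (\matrix_(i < size e, j < size e) coord (in_tuple e) j (nth 0 y i)).

Lemma frame_det_tuple m (e : m.-tuple V) y :
  frame_det e y = \det (\matrix_(i < m, j < m) coord e j (nth 0 y i)).
Proof.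
case: e => e em; have em' := eqP em; subst m; rewrite /frame_det /=.
by congr (\det _); apply/matrixP => i j; rewrite !mxE; congr (coord _ j _);
  apply: val_inj.
Qed.

(** Change of frame: the coordinate matrix in [e] is the one in [e'] times that of [e'] in [e]. *)
Lemma frame_det_mul e e' y : size e' = size e ->
  (forall i, (i < size e)%N -> nth 0 y i \in <<e'>>%VS) ->
  frame_det e y = frame_det e' y * frame_det e e'.
Proof.
move=> /eqP se yin; pose e't : (size e).-tuple V := Tuple se.
rewrite -[e']/(tval e't) (frame_det_tuple e't y) /frame_det -det_mulmx.
congr (\det _); apply/matrixP => i j; rewrite !mxE.
rewrite {1}(coord_span (yin i (ltn_ord i) : _ \in <<e't>>%VS)) linear_sum.
by apply: eq_bigr => l _; rewrite linearZ !mxE.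
Qed.

Lemma frame_det_id e : free e -> frame_det e e = 1.
Proof.
move=> fe; rewrite /frame_det -[RHS](det1 F (size e)); congr (\det _).
apply/matrixP => i j; rewrite !mxE.
exact: (@coord_free _ _ _ (in_tuple e)).
Qed.

Lemma size_free e : free e -> size e = \dim <<e>>.
Proof. by rewrite /free => /eqP. Qed.

Lemma frame_det_neq0 e y : free e -> free y -> (<<y>> = <<e>>)%VS ->
  frame_det e y != 0.
Proof.
move=> fe fy ye; have sz : size y = size e by rewrite !size_free ?ye.
have : frame_det e e != 0 by rewrite frame_det_id ?oner_eq0.
rewrite (frame_det_mul sz) ?mulf_eq0 ?negb_or; first by case/andP.
by move=> i ie; rewrite ye memv_span // mem_nth.
Qed.

Lemma coord_cons x e a u (j : 'I_(size e).+1) : free (x :: e) ->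
  u \in <<e>>%VS ->
  coord (in_tuple (x :: e)) j (a *: x + u) =
  oapp (fun i => coord (in_tuple e) i u) a (unlift ord0 j).
Proof.
move=> fxe ue; pose c (i : 'I_(size e).+1) :=
  oapp (fun i => coord (in_tuple e) i u) a (unlift ord0 i).
rewrite {1}(coord_span (ue : u \in <<in_tuple e>>%VS)).
rewrite -[oapp _ _ _]/(c j) -(@coord_sum_free _ _ _ (in_tuple (x :: e)) c j) //.
congr (coord _ _ _); rewrite big_ord_recl /c unlift_none /=; congr (_ + _).
by apply: eq_bigr => i _; rewrite liftK.
Qed.

(** The first row is the first unit vector; expanding along it deletes the first column, where the
    multiples of [x] sit. *)
Lemma frame_det_cons x e z z' : free (x :: e) ->
  (forall i, (i < size e)%N -> nth 0 z' i \in <<e>>%VS) ->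
  (forall i, (i < size e)%N -> exists a, nth 0 z i = a *: x + nth 0 z' i) ->
  frame_det (x :: e) (x :: z) = frame_det e z'.
Proof.
move=> fxe z'e zz'; rewrite /frame_det (expand_det_row _ ord0) big_ord_recl.
have xE (j : 'I_(size e).+1) : coord (in_tuple (x :: e)) j x = (j == ord0)%:R.
  have := @coord_cons x e 1 0 j fxe (mem0v _); rewrite scale1r addr0 => ->.
  by case: unliftP => [i|] -> //=; rewrite linear0.
rewrite big1 => [|j _]; last by rewrite mxE /= xE mul0r.
rewrite addr0 mxE /= xE eqxx mul1r /cofactor addn0 expr0 mul1r.
congr (\det _); apply/matrixP => i j; rewrite !mxE /=.
have [a ->] := zz' i (ltn_ord i).
by rewrite coord_cons ?z'e ?liftK.
Qed.

Lemma frame_det_scalar e x y : (1 < size e)%N ->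
  scalar (fun u => frame_det e [:: x, u & y]).
Proof.
move=> e1 a u v; rewrite /frame_det; pose i1 := Ordinal e1.
rewrite -[X in _ = _ + X]mul1r.
apply: (@determinant_multilinear _ _ _ _ _ i1).
- by apply/rowP => j; rewrite !mxE /= linearP mul1r.
- apply/matrixP => i j; rewrite !mxE; congr (coord _ _ _).
  have : (lift i1 i != 1 :> nat)%N by rewrite eq_sym (neq_bump 1).
  by case: (nat_of_ord (lift i1 i)) => [|[]].
- apply/matrixP => i j; rewrite !mxE; congr (coord _ _ _).
  have : (lift i1 i != 1 :> nat)%N by rewrite eq_sym (neq_bump 1).
  by case: (nat_of_ord (lift i1 i)) => [|[]].
Qed.

Lemma frame_det_eq_rows e y i j : (i < size e)%N -> (j < size e)%N -> i != j ->
  nth 0 y i = nth 0 y j -> frame_det e y = 0.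
Proof.
move=> ie je ij yij.
apply: (@determinant_alternate _ _ _ (Ordinal ie) (Ordinal je)) => // l.
by rewrite !mxE /= yij.
Qed.

Lemma frame_det_span e x u y : size e = (size y).+2 -> u \in <<y>>%VS ->
  frame_det e [:: x, u & y] = 0.
Proof.
move=> se uy; have e1 : (1 < size e)%N by rewrite se.
have lin := frame_det_scalar x y e1.
rewrite (coord_span (uy : u \in <<in_tuple y>>%VS)).
elim/big_ind: _ => [|v w v0 w0|i _]; first exact: (linform0 lin).
  by rewrite (linformD lin) v0 w0 addr0.
rewrite (linformZ lin) (@frame_det_eq_rows _ _ 1 i.+2) ?mulr0 //.
by rewrite se !ltnS.
Qed.

Lemma frame_det_dup e x y : (1 < size e)%N -> frame_det e [:: x, x & y] = 0.
Proof. by move=> e1; apply: (@frame_det_eq_rows _ _ 0 1) => //;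
  exact: ltnW. Qed.

End FrameDet.

Section FrameDetMap.

Variables (F : fieldType) (U V : vectType F) (h : {linear U -> V}).

Lemma frame_det_map (e y : seq U) : free (map h e) ->
  (forall i, (i < size e)%N -> nth 0 y i \in <<e>>%VS) ->
  frame_det (map h e) (map h y) = frame_det e y.
Proof.
move=> fe ye; pose t := [tuple of map h (in_tuple e)].
rewrite -[map h e]/(tval t) frame_det_tuple; congr (\det _).
apply/matrixP => i j; rewrite !mxE.
have -> : nth 0 (map h y) i = h (nth 0 y i).
  have [iy|yi] := ltnP i (size y); first exact: nth_map.
  by rewrite !nth_default ?size_map // linear0.
rewrite {1}(coord_span (ye i (ltn_ord i) : _ \in <<in_tuple e>>%VS)) linear_sum.
under eq_bigr => l _.
  rewrite linearZ /= -(nth_map 0 0 h) // -[map h e]/(tval t).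
over.
by rewrite coord_sum_free.
Qed.

End FrameDetMap.

(** * Incidence numbers and the square of the boundary *)

Section Incidence.

Variables (R : realFieldType) (V : vectType R) (I : finType) (g : I -> V -> R).
Hypothesis g_lin : forall i, scalar (g i).

Local Notation "x ⊑ y" := (in_closure g x y) (at level 70).
Local Notation in_span := (in_span g).
Local Notation ray_over := (ray_over g).

Variables (kk : fieldType) (T : finType) (pt : T -> V) (O : T -> seq V).
Variable (Tb : V -> Prop).
Hypothesis Tb_closed : forall x y, Tb x -> y ⊑ x -> Tb y.
Hypothesis pt_surj : forall x, Tb x -> exists c, x ⊑ pt c /\ pt c ⊑ x.
Hypothesis pt_inj : forall c c', pt c ⊑ pt c' -> pt c' ⊑ pt c -> c = c'.
Hypothesis pt_Tb : forall c, Tb (pt c).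
Hypothesis O_free : forall c, free (O c).
Hypothesis O_span : forall c u, u \in <<O c>>%VS <-> in_span (pt c) u.

Let le_trans' := @in_closure_trans R V I g.
Let le_refl' := in_closure_refl g.

Definition facet c' c : bool :=
  `[< pt c' ⊑ pt c >] && (size (O c) == (size (O c')).+1).

(* The sign comparing the frame of [c] with an inward vector followed by the
   frame of [c']. *)
Definition inc c c' : int := sgz (frame_det (O c) (pt c :: O c')).

Definition inc_mx c c' : kk := if facet c' c then (inc c c')%:~R else 0.

Lemma O_le c c' : pt c' ⊑ pt c -> (<<O c'>> <= <<O c>>)%VS.
Proof.
move=> c'c; apply/subvP => u /O_span c'u; apply/O_span.
exact: in_span_closure c'u.
Qed.

Lemma facet_ncl c c' : facet c' c -> ~ pt c ⊑ pt c'.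
Proof.
move=> /andP[/asboolP c'c /eqP sz] cc'.
have E : (<<O c>> = <<O c'>>)%VS.
  by apply/eqP; rewrite eqEsubv !O_le.
move: sz; rewrite !size_free // E => /eqP.
by rewrite eqn_leq ltnn andbF.
Qed.

Lemma free_pt_cons c c' : pt c' ⊑ pt c -> ~ pt c ⊑ pt c' -> free (pt c :: O c').
Proof.
move=> c'c ncc'; rewrite free_cons O_free andbT; apply/negP => /O_span cs.
by apply: ncc'; exact: in_closure_common (le_refl' _) c'c cs.
Qed.

Lemma span_pt_cons_le c c' : pt c' ⊑ pt c -> (<<pt c :: O c'>> <= <<O c>>)%VS.
Proof.
move=> c'c; rewrite span_cons subv_add O_le // andbT -memvE.
exact/O_span.
Qed.

Lemma span_facet c c' : facet c' c -> (<<pt c :: O c'>> = <<O c>>)%VS.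
Proof.
move=> fc; have /andP[/asboolP c'c /eqP sz] := fc.
have fr := free_pt_cons c'c (facet_ncl fc).
by apply/eqP; rewrite eqEdim span_pt_cons_le //= -!size_free //= sz.
Qed.

Lemma facet_det_neq0 c c' : facet c' c -> frame_det (O c) (pt c :: O c') != 0.
Proof.
move=> fc; have /andP[/asboolP c'c _] := fc; apply: frame_det_neq0 => //.
  exact: free_pt_cons (facet_ncl fc).
exact: span_facet.
Qed.

Lemma inc_sign c c' : facet c' c -> inc c c' = 1 \/ inc c c' = -1.
Proof.
move=> /facet_det_neq0; rewrite /inc neq_lt => /orP[/ltr0_sgz|/gtr0_sgz] ->.
  by right.
by left.
Qed.

Lemma inc_mx_facet c c' : (inc_mx c c' != 0) = facet c' c.
Proof.
rewrite /inc_mx; case: ifP => [fc|_]; last by rewrite eqxx.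
by case: (inc_sign fc) => ->; rewrite ?mulrN1z ?oppr_eq0 oner_eq0.
Qed.

Lemma inc_mx_face c c' : inc_mx c c' != 0 -> pt c' ⊑ pt c /\ c != c'.
Proof.
rewrite inc_mx_facet => fc; have /andP[/asboolP c'c /eqP sz] := fc; split=> //.
by apply/eqP => E; rewrite E in sz; move/eqP: sz; rewrite eqn_leq ltnn andbF.
Qed.

Lemma ray_facet c c' : pt c' ⊑ pt c -> ~ pt c ⊑ pt c' ->
  ray_over (pt c') (pt c) -> facet c' c.
Proof.
move=> c'c ncc' ray; apply/andP; split; first exact/asboolP.
rewrite -[_.+1]/(size (pt c :: O c')) !size_free ?free_pt_cons //.
suff -> : (<<pt c :: O c'>> = <<O c>>)%VS by [].
apply/eqP; rewrite eqEsubv span_pt_cons_le //=; apply/subvP => u /O_span/ray[a].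
move=> /O_span ua; rewrite span_cons -(subrK (a *: pt c) u) addrC.
by apply: memv_add => //; rewrite memvZ // memv_line.
Qed.

Lemma inc_mx_ray c c' : pt c' ⊑ pt c -> ~ pt c ⊑ pt c' ->
  ray_over (pt c') (pt c) -> inc_mx c c' != 0.
Proof. by move=> *; rewrite inc_mx_facet; exact: ray_facet. Qed.

(** The comparison of [O c] with [[:: pt c, pt c1 & O b]] factors through the frame [pt c :: O c1],
    and determinants multiply. *)
Lemma inc_mul c c1 b : facet c1 c -> facet b c1 ->
  inc c c1 * inc c1 b = sgz (frame_det (O c) [:: pt c, pt c1 & O b]).
Proof.
move=> fc fb; have /andP[/asboolP c1c /eqP sc] := fc.
have /andP[/asboolP bc1 /eqP sb] := fb.
have fr := free_pt_cons c1c (facet_ncl fc).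
have yin i : nth 0 (pt c1 :: O b) i \in <<O c1>>%VS.
  have [ib|ib] := ltnP i (size (pt c1 :: O b)); last first.
    by rewrite nth_default ?mem0v.
  by apply: (subvP (span_pt_cons_le bc1)); rewrite memv_span // mem_nth.
rewrite (@frame_det_mul _ _ _ (pt c :: O c1)) ?sc //; last first.
  move=> [|i] _ /=; first by rewrite memv_span // mem_head.
  by rewrite (subvP _ _ (yin i)) // span_cons addvSr.
rewrite (@frame_det_cons _ _ (pt c) (O c1) (pt c1 :: O b) (pt c1 :: O b)) //.
  by rewrite sgzM mulrC.
by move=> i _; exists 0; rewrite scale0r add0r.
Qed.

Section Diamond.

Variables (c b : T).
Hypothesis bc : pt b ⊑ pt c.
Hypothesis szcb : size (O c) = (size (O b)).+2.

Let l u := frame_det (O c) [:: pt c, u & O b].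

Let l_lin : scalar l.
Proof. by apply: frame_det_scalar; rewrite szcb. Qed.

Let l_b u : in_span (pt b) u -> l u = 0.
Proof. by move=> /O_span bu; exact: frame_det_span. Qed.

Let l_c : l (pt c) = 0.
Proof. by apply: frame_det_dup; rewrite szcb. Qed.

Let between c1 := facet c1 c && facet b c1.

Let ncb : ~ pt c ⊑ pt b.
Proof.
move=> cb; have E : (<<O c>> = <<O b>>)%VS.
  by apply/eqP; rewrite eqEsubv !O_le.
by move: szcb; rewrite !size_free // E; elim: (\dim _) => // m IH [].
Qed.

(** A vector in the span of [c] with the right sign of [l] is pushed into the closed cell by adding
    a multiple of [pt c], where [l] vanishes. A ray over [b] on this side is an intermediate
    cell. *)
Let exists_pos s : s != 0 -> exists2 c1, between c1 & 0 < s * l (pt c1).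
Proof.
move=> s0.
have fr := free_pt_cons bc ncb.
have [u cu nu] : exists2 u, u \in <<O c>>%VS & u \notin <<pt c :: O b>>%VS.
  apply/subvPn; apply/negP => /dimvS.
  by rewrite -!size_free //= szcb ltnn.
have lu : l u != 0.
  have fr' : free [:: pt c, u & O b].
    have pe : perm_eq [:: pt c, u & O b] [:: u, pt c & O b].
      by apply/seq.permP => p /=; rewrite addnCA.
    by rewrite (perm_free pe) free_cons nu.
  apply: frame_det_neq0 => //; apply/eqP;
    rewrite eqEdim -!size_free //= szcb leqnn andbT.
  rewrite span_cons subv_add -memvE; apply/andP; split; first exact/O_span.
  by rewrite span_cons subv_add -memvE cu O_le.
pose v := (s * l u) *: u; pose n x := s * l x.
have n_lin : scalar n by move=> a x y; rewrite /n l_lin; ring.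
have n_b x : in_span (pt b) x -> n x = 0 by move=> bx; rewrite /n l_b ?mulr0.
have nv : 0 < n v.
  rewrite /n (linformZ l_lin); have ->
    : s * (s * l u * l u) = (s * l u) ^+ 2 by ring.
  by rewrite exprn_even_gt0 //= mulf_neq0.
have [i c0|N [_ vc]] := @in_closure_shift _ _ _ _ g_lin (pt c) (pt c) v (le_refl' _).
  left; rewrite (linformZ (g_lin i)); move: cu => /O_span/(_ i c0) ->.
  by rewrite mulr0.
have [|f [bf fc nf ray]] := exists_ray g_lin n_lin (n_b _ (@in_span_refl _ _ _ _ _)) bc vc.
  have nc : n (pt c) = 0 by rewrite /n l_c mulr0.
  by rewrite (linformD n_lin) (linformZ n_lin N) nc mulr0 addr0.
have nfb : ~ f ⊑ pt b by move=> /in_closure_span/n_b n0; rewrite n0 ltxx in nf.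
have [c1 [fc1 c1f]] := pt_surj (Tb_closed (pt_Tb c) fc).
have bc1 := le_trans' bf fc1.
have nc1b : ~ pt c1 ⊑ pt b by move=> /(le_trans' fc1).
have fb : facet b c1.
  by apply: ray_facet => //; apply: ray_over_eqv ray.
exists c1.
  rewrite /between fb andbT /facet; apply/andP; split.
    by apply/asboolP; exact: le_trans' fc.
  by case/andP: fb => _ /eqP ->; rewrite szcb.
have [//|//] := ray_over_closure g_lin n_lin n_b bf ray nf c1f.
Qed.

Let between_neq0 c1 : between c1 -> l (pt c1) != 0.
Proof.
move=> /andP[f1 f2]; rewrite -sgz_eq0 -inc_mul // mulf_eq0 negb_or.
by case: (inc_sign f1) => ->; case: (inc_sign f2) => ->.
Qed.

(** The vectors [pt c], [pt c2] and [O b] span the span of [c]; comparing values of [l] shows that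
    the coefficient of [pt c2] is positive. *)
Let between_decomp c1 c2 s : between c1 -> between c2 -> 0 < s * l (pt c1) ->
  0 < s * l (pt c2) -> exists2 ab : R * R, 0 < ab.1 &
    forall i, g i (pt b) = 0 -> g i (pt c1) = ab.1 * g i (pt c2) + ab.2 * g i (pt c).
Proof.
move=> /andP[f1 f1'] /andP[f2 f2'] l1 l2.
have /andP[/asboolP c1c _] := f1.
have := subvP (O_le c1c) (pt c1) (iffRL (O_span _ _) (@in_span_refl _ _ _ _ _)).
rewrite -(span_facet f2) span_cons => /memv_addP[_ /vlineP[be ->] [y]].
rewrite -(span_facet f2') span_cons => /memv_addP[_ /vlineP[al ->] [z zb ->]] xE.
have {}zb := iffLR (O_span _ _) zb.
have lE : l (pt c1) = al * l (pt c2).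
  rewrite xE !(linformD l_lin) !(linformZ l_lin) l_c (l_b zb).
  by rewrite mulr0 add0r addr0.
exists (al, be) => /= [|i b0].
  by move: l1; rewrite lE mulrCA pmulr_lgt0.
rewrite xE !(linformD (g_lin i)) !(linformZ (g_lin i)) zb //.
by rewrite addr0 addrC.
Qed.

(** Modulo [b], [c1] is [al c2 + be c] with [al] positive. A positive [be] would put [c] in the
    closure of [c1], a negative one in that of [c2]. Both are facets of [c], so [be] is zero and the
    cells agree. *)
Let between_uniq c1 c2 s : between c1 -> between c2 -> 0 < s * l (pt c1) ->
  0 < s * l (pt c2) -> c1 = c2.
Proof.
move=> /[dup] bt1 /andP[f1 f1'] /[dup] bt2 /andP[f2 f2'] l1 l2.
have /andP[/asboolP c1c _] := f1; have /andP[/asboolP c2c _] := f2.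
have /andP[/asboolP bc1 _] := f1'; have /andP[/asboolP bc2 _] := f2'.
have absorb x y (al be : R) : pt b ⊑ x -> y ⊑ pt c -> 0 < al -> 0 < be ->
    (forall i, g i (pt b) = 0 -> g i x = al * g i y + be * g i (pt c)) ->
    pt c ⊑ x.
  move=> bx yc al0 be0 xE; apply: (@sign_span _ _ _ _ _ _ (pt b)) => // i b0.
  have [->|c0] := eqVneq (g i (pt c)) 0; [by left|right].
  rewrite (xE i b0) mulrDr addrC ltr_pwDl //.
    by rewrite mulrCA mulr_gt0 // -expr2 exprn_even_gt0.
  case: (yc i) => [->|/ltW h]; first by rewrite !mulr0.
  by rewrite mulrCA mulr_ge0 ?(ltW al0) // mulrC.
have prop x y (al : R) : pt b ⊑ x -> pt b ⊑ y -> 0 < al ->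
    (forall i, g i (pt b) = 0 -> g i x = al * g i y) -> x ⊑ y.
  move=> bx by_ al0 xE; apply: (@sign_span _ _ _ _ _ _ (pt b)) => // i b0.
  rewrite (xE i b0); have [->|y0] := eqVneq (g i y) 0; [by left;
    rewrite mulr0|right].
  by rewrite -mulrA mulr_gt0 // -expr2 exprn_even_gt0.
have [[al be] /= al0 xE] := between_decomp bt1 bt2 l1 l2.
have alV : 0 < al^-1 by rewrite invr_gt0.
have an0 : al != 0 by rewrite gt_eqF.
have [be0|be0|be0] := ltgtP be 0.
- case: (facet_ncl f2); apply: (absorb _ (pt c1) al^-1 (- be / al)) => //.
    by rewrite divr_gt0 // oppr_gt0.
  by move=> i b0; rewrite (xE i b0); field.
- by case: (facet_ncl f1); apply: (absorb _ (pt c2) al be).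
- rewrite be0 in xE; apply: pt_inj;
  [apply: (prop _ _ al)|apply: (prop _ _ al^-1)] => //.
    by move=> i b0; rewrite (xE i b0) mul0r addr0.
  by move=> i b0; rewrite (xE i b0) mul0r addr0 mulKf.
Qed.

Lemma inc_mx_diamond : \sum_(c1 | between c1) ((inc c c1 * inc c1 b)%:~R : kk) = 0.
Proof.
have [cp btp lp] := exists_pos (oner_neq0 R).
have [|cm btm lm] := @exists_pos (-1); first by rewrite oppr_eq0 oner_eq0.
have cmp : cm != cp.
  apply: contraTneq lm => ->; rewrite mulN1r oppr_gt0 -leNgt.
  by move: lp; rewrite mul1r => /ltW.
rewrite (bigD1 cp) //= (bigD1 cm) /= ?btm // big1 => [|c1 /andP[/andP[bt1 n1] n2]].
  move: btp btm => /andP[f1 f1'] /andP[f2 f2'].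
  rewrite !inc_mul // -/(l _) -/(l _) gtr0_sgz; last by move: lp; rewrite mul1r.
  rewrite ltr0_sgz; last by move: lm; rewrite mulN1r oppr_gt0.
  by rewrite addr0 -intrD.
have := between_neq0 bt1; rewrite neq_lt => /orP[h|h].
  by move: n2; rewrite (@between_uniq c1 cm (-1)) ?eqxx // mulN1r oppr_gt0.
by move: n1; rewrite (@between_uniq c1 cp 1) ?eqxx // mul1r.
Qed.

End Diamond.

Lemma inc_mx_square0 c b : \sum_c1 inc_mx c c1 * inc_mx c1 b = 0.
Proof.
have E : \sum_c1 inc_mx c c1 * inc_mx c1 b =
    \sum_(c1 | facet c1 c && facet b c1) (inc c c1 * inc c1 b)%:~R.
  rewrite [RHS]big_mkcond; apply: eq_bigr => c1 _; rewrite /inc_mx.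
  by case: (facet c1 c); case: (facet b c1); rewrite ?mul0r ?mulr0 // intrM.
have [[c1 /andP[fc fb]]|no] := pselect (exists c1, facet c1 c && facet b c1).
  have /andP[/asboolP c1c /eqP sc] := fc;
    have /andP[/asboolP bc1 /eqP sb] := fb.
  rewrite E inc_mx_diamond //; first exact: le_trans' c1c.
  by rewrite sc sb.
by rewrite E big1 // => c1 h; case: no; exists c1.
Qed.

End Incidence.
(** * Monomial ideals and cellular resolutions *)

Section MonomialIdeal.

Variables (k : fieldType) (N : nat).
Implicit Types (p q : {mpoly k[N]}) (m w : 'X_{1..N}) (M : set 'X_{1..N}).

Lemma mcoeffMX_le p w m : (p * 'X_[w])@_m != 0 -> (w <= m)%MM.
Proof.
rewrite -mcoeff_msupp (perm_mem (msuppMX p w)) => /mapP[m' _ ->].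
exact: lem_addr.
Qed.

(** Each monomial of a multiple of a generator is divisible by it; conversely [p] is split into its
    terms, each a multiple of a generator chosen for it. *)
Lemma monomial_idealP M p :
  ideal_gen [set 'X_[w] | w in M] p <->
  (forall m, p@_m != 0 -> exists2 w, M w & (w <= m)%MM).
Proof.
split=> [[r rM ->] m|pM].
  rewrite raddf_sum /= => nz.
  have [[a ar anz]|no] := pselect (exists2 a, a \in r & (a.1 * a.2)@_m != 0).
    by have [w Mw wE] := rM _ ar; exists w => //; apply: (@mcoeffMX_le a.1);
      rewrite wE.
  case/eqP: nz; rewrite big_seq big1 // => a ar.
  by apply/eqP/negP => /negP anz; apply: no; exists a.
have /choice[w wP] : forall m, exists w, p@_m != 0 -> M w /\ (w <= m)%MM.
  move=> m; have [/pM[w Mw wm]|_] := boolP (p@_m != 0); first by exists w.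
  by exists m.
exists [seq (p@_m *: 'X_[(m - w m)%MM], 'X_[w m]) | m <- msupp p].
  move=> _ /mapP[m mp ->]; rewrite mcoeff_msupp in mp.
  by have [Mw _] := wP _ mp; exists (w m).
rewrite big_map [LHS]mpolyE big_seq [RHS]big_seq; apply: eq_bigr => m mp.
rewrite mcoeff_msupp in mp; have [_ wm] := wP _ mp.
by rewrite /= -scalerAl -mpolyXD submK.
Qed.

Lemma principal_monomialP w p :
  ideal_gen [set 'X_[w]] p <-> (forall m, p@_m != 0 -> (w <= m)%MM).
Proof.
rewrite -(image_set1 (fun w : 'X_{1..N} => 'X_[k, w])).
split=> [/monomial_idealP h m /h[_ -> //]|h].
by apply/monomial_idealP => m /h wm; exists w.
Qed.

Lemma mcoeff_intM (z : int) p m : (z%:~R * p)@_m = z%:~R * p@_m.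
Proof. by rewrite !mulrzl raddfMz. Qed.

End MonomialIdeal.

(** * Cellular chains, one monomial degree at a time *)

Section CellularResolution.

Variables (k : fieldType) (X : cell_complex) (N : nat).
Variable lab : cx_cell X -> 'X_{1..N}.

Definition bd_mx (c c' : acell X) : k :=
  if aface c' c && (adim c' == adim c - 1) then (ainc c c')%:~R else 0.

Definition label_cells m : {set acell X} :=
  [set c | (cell_label lab c <= m)%MM].

Hypothesis bd_mx_square0 : forall c c'', \sum_c' bd_mx c c' * bd_mx c' c'' = 0.
Hypothesis label_mono : forall c c', aface c' c ->
  (cell_label lab c' <= cell_label lab c)%MM.
Hypothesis label_exact : forall m,
  (exists c : cx_cell X, (cell_label lab (Some c) <= m)%MM) ->
  exact_on bd_mx (label_cells m).
Hypothesis label_vertex : forall v, cx_vertex v ->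
  cell_label lab (Some v) = lab v.
Hypothesis label_neq : forall c' c : cx_cell X, cx_face c' c -> c' != c ->
  cell_label lab (Some c) <> cell_label lab (Some c').

Local Notation C := (cellular_chain k lab).
Local Notation SC := (sub_chain k lab).

Lemma boundary_bd (f : {ffun acell X -> k}) : boundary f = bd bd_mx f.
Proof.
apply/ffunP => c'; rewrite !ffunE big_mkcond; apply: eq_bigr => c _.
by rewrite /bd_mx; case: ifP => // _; rewrite mul0r.
Qed.

Lemma boundary_square0 (f : {ffun acell X -> k}) : boundary (boundary f) = 0.
Proof.
apply/ffunP => c; rewrite !boundary_bd [RHS]ffunE.
have := @bd_restrict_bd _ _ bd_mx [set: acell X]%SET f c.
have -> : restrict [set: acell X]%SET (bd bd_mx f) = bd bd_mx f.
  by apply/ffunP => b; rewrite restrictE ?finset.in_setT.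
apply; rewrite ?finset.in_setT //.
  move=> a b _ _; rewrite -[RHS](bd_mx_square0 a b); apply: eq_bigl => c'.
  by rewrite finset.in_setT.
by move=> b; rewrite finset.in_setT.
Qed.

Lemma boundary_sub_chain m i f : SC m (i + 1) f -> SC m i (boundary f).
Proof.
move=> fC c'; rewrite ffunE => nz.
have [[c /andP[cc' dc] cnz]|no] := pselect (exists2 c,
    aface c' c && (adim c' == adim c - 1) & f c != 0).
  have [dimc lc] := fC c cnz; split; first by rewrite (eqP dc) dimc addrK.
  exact: lepm_trans (label_mono cc') lc.
case/eqP: nz; rewrite big1 // => c cc'; apply/eqP/negP => /negP.
by rewrite mulf_eq0 negb_or => /andP[_ nz]; apply: no; exists c.
Qed.

(** [exact_on] ignores dimension. Keeping only the part of the primitive in dimension [i + 1]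
    restores the grading, as the boundary lowers dimension by one. *)
Lemma sub_chain_exact m :
  (exists c : cx_cell X, (cell_label lab (Some c) <= m)%MM) ->
  forall i, exact_at (SC m) i.
Proof.
move=> /label_exact ex i; apply/seteqP; split=> [z [zC z0]|_ [f fC <-]];
  last first.
  by split; [exact: boundary_sub_chain | exact: boundary_square0].
have zS : supported (label_cells m) z.
  by move=> c; rewrite inE; apply: contraNeq => /zC[].
have [|g gS gE] := ex z zS.
  by move=> c _; rewrite -boundary_bd z0 ffunE.
pose g' : {ffun acell X -> k} := [ffun c => if adim c == i + 1 then g c else 0].
have g'C : SC m (i + 1) g'.
  move=> c; rewrite ffunE; case: ifP => [/eqP dimc gnz|_]; last by rewrite eqxx.
  split=> //; apply: contraNT gnz => lc.
  by apply/eqP/gS; rewrite inE.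
exists g' => //; apply/ffunP => c.
have [dimc|dimc] := eqVneq (adim c) i; last first.
  have -> : z c = 0 by apply/eqP; apply: contraNT dimc => /zC[-> _].
  apply/eqP; apply: contraNT dimc => /(boundary_sub_chain g'C)[-> _] //.
have [cm|cm] := boolP (c \in label_cells m); last first.
  rewrite zS //; apply/eqP; apply: contraNT cm => /(boundary_sub_chain g'C)[_].
  by rewrite inE.
rewrite -gE // -boundary_bd !ffunE; apply: eq_bigr => b /andP[_].
by rewrite dimc eq_sym subr_eq ffunE => ->.
Qed.

(** The component in the fine degree [m]. The differential is made of signed inclusions of ideals,
    so it acts on these coefficients by the incidence numbers alone. *)
Definition coef_chain m (f : {ffun acell X ->
  {mpoly k[N]}}) : {ffun acell X -> k} :=
  [ffun c => (f c)@_m].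

Lemma coef_boundary m f : coef_chain m (boundary f) = boundary (coef_chain m f).
Proof.
apply/ffunP => c; rewrite !ffunE raddf_sum; apply: eq_bigr => b _.
by rewrite /= mcoeff_intM ffunE.
Qed.

Lemma cellular_chainP i f : C i f <-> forall m, SC m i (coef_chain m f).
Proof.
split=> [fC m c|fC c].
  rewrite ffunE; have := fC c; case: eqP => [dimc|_ ->];
    last by rewrite mcoeff0 eqxx.
  by move=> /principal_monomialP h /h.
case: eqP => dimc.
  by apply/principal_monomialP => m nz; have [] := fC m c; rewrite ?ffunE.
apply/mpolyP => m; rewrite mcoeff0; apply/eqP/negP => /negP nz.
by have [] := fC m c; rewrite ?ffunE.
Qed.

Lemma coef_chain_inj f f' : (forall m, coef_chain m f = coef_chain m f') ->
  f = f'.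
Proof.
move=> h; apply/ffunP => c; apply/mpolyP => m.
by have /ffunP/(_ c) := h m; rewrite !ffunE.
Qed.

(** Primitives chosen degree by degree are assembled over the finitely many monomials occurring in
    [z]. *)
Lemma boundary_lift i z :
  (forall m, (@boundary k X @` SC m (i + 1)) (coef_chain m z)) ->
  (@boundary _ X @` C (i + 1)) z.
Proof.
move=> h; have /choice[g gP] : forall m, exists g, SC m (i + 1) g /\
    boundary g = coef_chain m z by move=> m; have [g ? ?] := h m; exists g.
pose M := undup (flatten [seq msupp (z c : {mpoly k[N]}) | c <- enum (acell X)]).
have zM m c : m \notin M -> (z c)@_m = 0.
  rewrite mem_undup => mM; apply: memN_msupp_eq0; apply: contra mM => mz.
  by apply/flatten_mapP; exists c; rewrite ?mem_enum.
pose y : {ffun acell X -> {mpoly k[N]}} :=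
  [ffun c => \sum_(m <- M) g m c *: 'X_[m]].
have yE m : coef_chain m y = if m \in M then g m else 0.
  apply/ffunP => c; rewrite !ffunE raddf_sum /=.
  have [mM|mM] := boolP (m \in M).
    rewrite (bigD1_seq m) ?undup_uniq //= mcoeffZ mcoeffX eqxx mulr1 big1 ?addr0 //.
    by move=> m' /negbTE nm; rewrite mcoeffZ mcoeffX nm mulr0.
  rewrite ffunE big_seq big1 // => m' m'M; rewrite mcoeffZ mcoeffX.
  by case: eqP => [E|_]; [case/negP: mM; rewrite -E | rewrite mulr0].
exists y.
  apply/cellular_chainP => m; rewrite yE; case: ifP => _; first by case: (gP m).
  by move=> c; rewrite ffunE eqxx.
apply: coef_chain_inj => m; rewrite coef_boundary yE.
case: ifP => [_|/negbT mM]; first by case: (gP m).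
apply/ffunP => c; rewrite !ffunE zM // big1 // => b _.
by rewrite ffunE mulr0.
Qed.

Lemma zero_in_boundary m i : (@boundary k X @` SC m i) 0.
Proof.
exists 0; first by move=> c; rewrite ffunE eqxx.
by apply/ffunP => c; rewrite !ffunE big1 // => b _; rewrite ffunE mulr0.
Qed.

(** Degrees divisible by the label of some nonempty cell are exact by acyclicity; in the others
    there are no nonzero chains of nonnegative dimension. *)
Lemma cellular_chain_exact i : 0 <= i -> exact_at C i.
Proof.
move=> i0; apply/seteqP; split=> [z [/cellular_chainP zC z0]|_ [f /cellular_chainP fC <-]].
  apply: boundary_lift => m.
  have [[c cm]|no] := pselect (exists c : cx_cell X, (cell_label lab (Some c) <= m)%MM).
    rewrite -(sub_chain_exact (ex_intro _ c cm) i); split=> //.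
    by rewrite -coef_boundary z0; apply/ffunP => b; rewrite !ffunE mcoeff0.
  have -> : coef_chain m z = 0; last exact: zero_in_boundary.
  apply/ffunP => c; rewrite [RHS]ffunE;
    apply/eqP/negP => /negP /(zC m)[dimc lc].
  case: c dimc lc => [c _ lc|dimc _]; first by apply: no; exists c.
  by rewrite -dimc in i0.
split; first by apply/cellular_chainP => m; rewrite coef_boundary;
  exact: boundary_sub_chain.
apply: coef_chain_inj => m; rewrite !coef_boundary boundary_square0.
by apply/ffunP => c; rewrite !ffunE mcoeff0.
Qed.

Variable I : set {mpoly k[N]}.
Hypothesis I_gen : I = ideal_gen [set 'X_[lab v] | v in @cx_vertex X].

Lemma I_genP p : I p <->
  (forall m, p@_m != 0 -> exists2 v, cx_vertex v & (lab v <= m)%MM).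
Proof.
have -> : I = ideal_gen [set 'X_[w] | w in [set lab v | v in @cx_vertex X]].
  by rewrite I_gen -image_comp.
split=> [/monomial_idealP h m /h[_ [v vv <-] vm]|h]; first by exists v.
by apply/monomial_idealP => m /h[v vv vm]; exists (lab v) => //; exists v.
Qed.

Lemma cellular_chain_image : [set boundary f None | f in C 0] = I.
Proof.
apply/seteqP; split=> [_ [f /cellular_chainP fC <-]|p /I_genP pI].
  apply/I_genP => m.
  have -> : (boundary f None)@_m = coef_chain m (boundary f) None by rewrite [RHS]ffunE.
  rewrite coef_boundary ffunE => nz.
  have [[c dc cnz]|no] := pselect (exists2 c : acell X,
      aface None c && (adim (None : acell X) == adim c - 1) & coef_chain m f c != 0).
    have [] := fC m c cnz; case: c dc cnz => [v|//] _ _ [v0] lv.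
    by exists v => //; rewrite -label_vertex.
  case/eqP: nz; rewrite big1 // => c cc'; apply/eqP/negP => /negP.
  by rewrite mulf_eq0 negb_or => /andP[_ nz]; apply: no; exists c.
(* Placed on the empty cell, [p] is a cycle of dimension -1; exactness there gives a chain on the
   vertices with image [p]. *)
pose z : {ffun acell X -> {mpoly k[N]}} :=
  [ffun c => if c is None then p else 0].
have [|f fC fE] := @boundary_lift (-1) z; last first.
  by exists f; rewrite ?fE ?ffunE //; rewrite addNr in fC.
move=> m; have [pm|/pI[v vv vm]] := eqVneq p@_m 0.
  have -> : coef_chain m z = 0; last exact: zero_in_boundary.
  by apply/ffunP => -[c|]; rewrite !ffunE ?mcoeff0.
have ne : exists c : cx_cell X, (cell_label lab (Some c) <= m)%MM.
  by exists v; rewrite label_vertex.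
rewrite -(sub_chain_exact ne (-1)); split.
  move=> [c|]; rewrite !ffunE ?mcoeff0 ?eqxx // => _; split=> //.
  by apply/mnm_lepP => i; rewrite mnm0E.
apply/ffunP => c; rewrite !ffunE big1 // => -[b|] /andP[_ /eqP dc].
  by rewrite !ffunE mcoeff0 mulr0.
by rewrite /= mul0r.
Qed.

Lemma irrelevant_monomial (q : {mpoly k[N]}) w : w != 0%MM ->
  irrelevant_ideal (q * 'X_[w]).
Proof.
move=> w0; have [i wi] : exists i, (0 < w i)%N.
  apply: contrapT => no; case/eqP: w0; apply/mnmP => i; rewrite mnm0E.
  by apply/eqP; rewrite -leqn0 leqNgt; apply/negP => wi; apply: no; exists i.
exists [:: (q * 'X_[(w - U_(i))%MM], 'X_i)].
  by move=> a; rewrite inE => /eqP -> /=; exists i.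
rewrite big_seq1 /= -mulrA -mpolyXD submK //.
by apply/mnm_lepP => j; rewrite mnm1E; case: eqP => // <-.
Qed.

(** The entry from [c] to [c'] is, up to sign, the quotient of their labels, a nontrivial monomial
    since the labels differ. *)
Lemma cellular_chain_minimal i : 1 <= i ->
  @boundary _ X @` C i `<=` ideal_mul_chain (@irrelevant_ideal k N) (C (i - 1)).
Proof.
move=> i1 _ [f fC <-].
have /choice[a aE] : forall c, exists a, f c = a * 'X_[cell_label lab c].
  move=> c; have := fC c; case: eqP => [dimc [r rl ->]|_ ->]; last first.
    by exists 0; rewrite mul0r.
  exists (\sum_(x <- r) x.1); rewrite mulr_suml big_seq [RHS]big_seq.
  by apply: eq_bigr => x /rl ->.
pose P (cc : acell X * acell X) :=
  [&& aface cc.2 cc.1, adim cc.2 == adim cc.1 - 1 &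
  adim cc.1 == i].
pose e c' : {ffun acell X -> {mpoly k[N]}} :=
  [ffun c => if c == c' then 'X_[cell_label lab c'] else 0].
pose q (cc : acell X * acell X) : {mpoly k[N]} := (ainc cc.1 cc.2)%:~R *
  (a cc.1 * 'X_[(cell_label lab cc.1 - cell_label lab cc.2)%MM]).
have label_diff c c' : P (c, c') ->
    (cell_label lab c - cell_label lab c')%MM != 0%MM.
  move=> /and3P[/= cc' /eqP dc' /eqP dc].
  (* As [i] is at least 1, neither of the two cells is empty. *)
  have [c0 cE] : exists c0, c = Some c0.
    by case: c dc {cc' dc'} => [c0 _|E]; [exists c0 | rewrite -E in i1].
  have [c1 c1E] : exists c1, c' = Some c1.
    case: c' dc' {cc'} => [c1 _|/= E]; first by exists c1.
    by move: i1; rewrite -dc -[adim c](subrK 1) -E.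
  subst c c'; have ne : c1 != c0.
    by apply/eqP => E; move: dc'; rewrite E; lia.
  apply/eqP => E; apply: (label_neq cc' ne).
  by rewrite -(submK (label_mono cc')) E add0m.
(* One term for each incidence: [q] contains the quotient of labels, and [e] is the generator of the
   principal ideal of the face. *)
exists [seq (q cc, e cc.2) | cc <- enum [pred cc | P cc]].
  move=> _ /mapP[[c c'] + ->]; rewrite mem_enum inE => Pcc.
  split; first by rewrite /q mulrA; apply: irrelevant_monomial;
    exact: label_diff.
  move: Pcc => /and3P[/= cc' /eqP dc' /eqP dc] b.
  rewrite ffunE; have [->|_] := eqVneq b c'.
    rewrite dc' dc eqxx; apply/principal_monomialP => m; rewrite mcoeffX.
    by have [<-|_] := eqVneq _ m; rewrite ?lepm_refl // eqxx.
  by case: eqP => // _; apply/principal_monomialP => m; rewrite mcoeff0 eqxx.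
apply/ffunP => c'; rewrite big_map big_enum /= sum_ffunE [LHS]ffunE.
rewrite big_mkcond [RHS]big_mkcond /=.
rewrite (eq_bigr (fun cc => (fun c b => if P (c, b) then q (c, b) * e b c' else 0) cc.1 cc.2));
  last by move=> [c b] _ /=; rewrite inE; case: ifP => // _; rewrite ffunE.
rewrite -(pair_bigA _ (fun c b => if P (c, b) then q (c, b) * e b c' else 0)) /=.
apply: eq_bigr => c _; rewrite (bigD1 c') //= big1 ?addr0; last first.
  move=> b /negbTE bc'; case: ifP => // _; rewrite ffunE eq_sym bc'.
  by rewrite mulr0.
rewrite /P /= andbA; case: ifP => //= /andP[cc' dc'].
case: eqP => [dc|dc]; last first.
  have fc0 : f c = 0 by have := fC c; rewrite (introF eqP dc).
  by rewrite fc0 mulr0.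
by rewrite ffunE eqxx /q /= -!mulrA -mpolyXD submK ?label_mono // -aE.
Qed.

Theorem cellular_resolution : minimal_free_resolution lab I.
Proof.
split.
- exact: cellular_chain_exact.
- exact: cellular_chain_image.
- exact: cellular_chain_minimal.
Qed.

Theorem cellular_I_complex : is_I_complex lab I.
Proof.
by split=> // m ne i; exact: sub_chain_exact.
Qed.

End CellularResolution.
(** * Homogenization of an affine arrangement *)

Section Homogenization.

Variables (R : realType) (d n : nat) (A : arrangement R d n).
Implicit Types (v w u : 'cV[R]_d) (j : 'I_n).

Definition hspace : vectType R := ('cV[R]_d * R^o)%type.

(** The index [None] stands for the extra form [t] of the homogenization. *)
Definition hform (i : option 'I_n) (x : hspace) : R :=
  if i is Some j then fval A j x.1 - offset A j * (x.2 : R) else x.2.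

Lemma fvalP j a u v : fval A j (a *: u + v) = a * fval A j u + fval A j v.
Proof. by rewrite /fval linearP. Qed.

Lemma hform_lin i : scalar (hform i).
Proof.
case: i => [j|] a [u s] [v t] //.
rewrite -[LHS]/(fval A j (a *: u + v) - offset A j * (a * s + t)) fvalP /hform /=.
by ring.
Qed.

Local Notation "x ⊑ y" := (in_closure hform x y) (at level 70).

Definition hpt v : hspace := (v, 1).
Definition hdir u : hspace := (u, 0).

Lemma hform_hpt j v : hform (Some j) (hpt v) = fval A j v - offset A j.
Proof. by rewrite /hform /= mulr1. Qed.

Lemma hpt_closureP v w : hpt v ⊑ hpt w <->
  forall j, fval A j v = offset A j \/
    0 < (fval A j v - offset A j) * (fval A j w - offset A j).
Proof.
split=> [h j|h [j|]].
- have := h (Some j); rewrite !hform_hpt => -[/subr0_eq|]; [by left|by right].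
- by rewrite !hform_hpt; case: (h j) => [->|]; [left; rewrite subrr|right].
- by right; rewrite /= mulr1 ltr01.
Qed.

Lemma sign_vec_closure v w : sign_vec A v = sign_vec A w <->
  hpt v ⊑ hpt w /\ hpt w ⊑ hpt v.
Proof.
split=> [E|[vw wv]].
  suff H x y : sign_vec A x = sign_vec A y -> hpt x ⊑ hpt y by split; apply: H.
  move=> /ffunP {}E; apply/hpt_closureP => j; have := E j; rewrite !ffunE.
  case: (ltgtP (offset A j) (fval A j x)) => [xj|xj|->]; last by left.
    case: (ltgtP (offset A j) (fval A j y)) => // yj _; right.
    by rewrite mulr_gt0 ?subr_gt0.
  case: (ltgtP (offset A j) (fval A j y)) => // yj _; right.
  by rewrite nmulr_rgt0 subr_lt0.
apply/ffunP => j; rewrite !ffunE.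
move: vw wv => /hpt_closureP/(_ j) vw /hpt_closureP/(_ j) wv.
case: (ltgtP (offset A j) (fval A j v)) => vj.
- case: vw => [E|]; first by rewrite E ltxx in vj.
  by rewrite pmulr_rgt0 subr_gt0 // => ->.
- case: vw => [E|]; first by rewrite E ltxx in vj.
  rewrite nmulr_rgt0 subr_lt0 // => wj.
  by rewrite ltNge (ltW wj) /= wj.
- case: wv => [->|]; first by rewrite ltxx.
  by rewrite vj subrr mulr0 ltxx.
Qed.

(** The forms span the dual space, so the coordinate functionals vanish at [u] too. *)
Lemma essential u : (forall j, fval A j u = 0) -> u = 0.
Proof.
move=> u0.
have all0 (h : 'Hom('cV[R]_d, R^o)) : h u = 0.
  have : h \in <<codom (Defs.form A)>>%VS by rewrite form_span memvf.
  move=> /(@coord_span _ _ _ (in_tuple _)) ->; rewrite sum_lfunE big1 // => i _.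
  rewrite scale_lfunE; have : (codom (Defs.form A))`_i \in codom (Defs.form A).
    by apply: mem_nth.
  by move=> /codomP[j ->]; rewrite [Defs.form A j u]u0 scaler0.
apply/matrixP => i j; rewrite (ord1 j) [RHS]mxE.
pose ent (v : 'cV[R]_d) : R^o := v i 0.
have ent_lin : linear ent by move=> a v w; rewrite /ent !mxE.
pose e : {linear 'cV[R]_d -> R^o} :=
  HB.pack ent (GRing.isLinear.Build R 'cV[R]_d R^o _ ent ent_lin).
by have := all0 (linfun e); rewrite lfunE.
Qed.

Lemma hform_essential x : (forall i, hform i x = 0) -> x = 0.
Proof.
case: x => u a h; have a0 : a = 0 := h None; congr pair => //.
by apply: essential => j; have := h (Some j); rewrite /hform /= a0 mulr0 subr0.
Qed.

Lemma closure0_eq0 x : x ⊑ 0 -> x = 0.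
Proof.
move=> x0; apply: hform_essential => i; apply: (in_closure_eq0 x0).
exact: (linform0 (hform_lin i)).
Qed.

Lemma hpt_scale (x : hspace) : 0 < hform None x ->
  exists v, hpt v ⊑ x /\ x ⊑ hpt v.
Proof.
move=> x0; exists ((x.2 : R)^-1 *: x.1).
have -> : hpt ((x.2 : R)^-1 *: x.1) = (x.2 : R)^-1 *: x.
  by congr pair; rewrite /= /GRing.scale /= mulVf // gt_eqF.
split; [apply: in_closure_scale|apply: in_closure_unscale];
  by [exact: hform_lin | rewrite invr_gt0].
Qed.

(** Adding a multiple [N] of [hpt v] to the direction puts it in the cone over the cell of [v]. Its
    last coordinate is [N], so [N] is positive and dividing by it returns to height 1. *)
Lemma cell_step v u : in_span hform (hpt v) (hdir u) ->
  exists2 a, 0 < a & sign_vec A (v + a *: u) = sign_vec A v.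
Proof.
move=> vu.
have [i v0|N [vx xv]] := @in_closure_shift _ _ _ _ hform_lin (hpt v) (hpt v) (hdir u)
  (in_closure_refl _ _); first by left; exact: vu.
have N0 : 0 < N.
  case: (vx None) => [/eqP|]; first by rewrite /= oner_eq0.
  by rewrite (linformD (hform_lin None)) (linformZ (hform_lin None)) /= add0r mul1r mulr1.
exists N^-1; first by rewrite invr_gt0.
have E : hpt (v + N^-1 *: u) = N^-1 *: (hdir u + N *: hpt v).
  rewrite scalerDr scalerA mulVf ?gt_eqF // scale1r [RHS]addrC.
  by congr pair; rewrite /= /GRing.scale /= mulr0 addr0.
apply/sign_vec_closure; rewrite E; split.
  apply: in_closure_trans xv; apply: in_closure_scale; first exact: hform_lin.
  by rewrite invr_gt0.
apply: in_closure_trans vx _; apply: in_closure_unscale; first exact: hform_lin.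
by rewrite invr_gt0.
Qed.

(** The direction space of the intersection of the hyperplanes through [v]. *)
Definition flat_dir v : {vspace 'cV[R]_d} :=
  (\bigcap_(j | fval A j v == offset A j) lker (Defs.form A j))%VS.

Lemma flat_dirP v u : reflect (forall j, fval A j v = offset A j ->
  fval A j u = 0)
  (u \in flat_dir v).
Proof.
rewrite memvE; apply: (iffP subv_bigcapP) => [h j /eqP vj|h j /eqP vj].
  by have := h j vj; rewrite -memvE memv_ker => /eqP.
by rewrite -memvE memv_ker; apply/eqP; exact: h.
Qed.

(** Differences of points of the cell lie in [flat_dir A v]; conversely [cell_step] moves within the
    cell along any direction of this space. *)
Lemma hull_dirE v : hull_dir (cell A (sign_vec A v)) = flat_dir v.
Proof.
pose P (U : {vspace 'cV[R]_d}) :=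
  (forall x y, cell A (sign_vec A v) x -> cell A (sign_vec A v) y ->
    x - y \in U) /\
  forall U' : {vspace 'cV[R]_d}, (forall x y, cell A (sign_vec A v) x ->
    cell A (sign_vec A v) y -> x - y \in U') -> (U <= U')%VS.
have Pflat : P (flat_dir v).
  split=> [x y xv yv|U' U'P].
    apply/flat_dirP => j vj.
    have on z : cell A (sign_vec A v) z -> fval A j z = offset A j.
      move=> /sign_vec_closure[/hpt_closureP/(_ j)[//|]].
      by rewrite vj subrr mulr0 ltxx.
    rewrite -[x - y]addrC -scaleN1r fvalP on // on //.
    by rewrite mulN1r addNr.
  apply/subvP => u /flat_dirP uv.
  have [[j|] /=|a a0 E] := @cell_step v u.
  - by rewrite -/(hpt v) -/(hdir u) mulr1 mulr0 subr0 => /subr0_eq/uv.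
  - by move/eqP; rewrite oner_eq0.
  have := U'P _ v E erefl; rewrite addrAC subrr add0r => /(memvZ a^-1).
  by rewrite scalerA mulVf ?scale1r // gt_eqF.
have [H1 H2] : P (hull_dir (cell A (sign_vec A v))).
  by apply: (@xgetPex _ 0%VS P); exists (flat_dir v).
by case: Pflat => F1 F2; apply/eqP; rewrite eqEsubv H2 // F2.
Qed.

Lemma closure_boxP (D : set 'cV[R]_d) v : closure D v <->
  forall e : R, 0 < e -> exists2 w, D w & forall i, `|v i 0 - w i 0| < e.
Proof.
split=> [cl e e0|h B /nbhs_ballP[e /= e0 sB]].
  have [|w [Dw [_ bw]]] := cl (ball v e); first exact: nbhsx_ballx.
  by exists w => // i; exact: bw.
have [w Dw ew] := h e e0; exists w; split=> //; apply: sB; split=> // i j.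
by rewrite (ord1 j); exact: ew.
Qed.

Lemma fval_bound j v w e : (forall i, `|v i 0 - w i 0| <= e) ->
  `|fval A j v - fval A j w| <= e * \sum_i `|fval A j (delta_mx i 0)|.
Proof.
move=> h; have -> : fval A j v - fval A j w =
    \sum_i (v i 0 - w i 0) * fval A j (delta_mx i 0).
  have E : fval A j v - fval A j w = fval A j (v - w) by rewrite /fval linearB.
  rewrite E [v - w]matrix_sum_delta.
  under eq_bigr do rewrite big_ord1.
  rewrite /fval linear_sum; apply: eq_bigr => i _.
  by rewrite linearZ !mxE.
rewrite mulr_sumr; apply: le_trans (ler_norm_sum _ _ _) _.
by apply: ler_sum => i _; rewrite normrM ler_wpM2r.
Qed.

(** A nonzero value of a form keeps its sign under a small perturbation. Conversely, the segment
    from [x] to [w] runs in the cell of [w], except possibly at [x]. *)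
Lemma cell_closureP v w : cell A (sign_vec A v) `<=` closure (cell A (sign_vec A w))
  <-> hpt v ⊑ hpt w.
Proof.
split=> [/(_ v erefl)/closure_boxP cl|vw x /sign_vec_closure[xv vx]].
  apply/hpt_closureP => j; have [|vj] := eqVneq (fval A j v) (offset A j).
    by left.
  right; set m := \sum_i `|fval A j (delta_mx i 0)|.
  have m0 : 0 <= m by apply: sumr_ge0.
  have p0 : 0 < `|fval A j v - offset A j| by rewrite normr_gt0 subr_eq0.
  have m1 : 0 < m + 1 by rewrite ltr_wpDl.
  have [x /sign_vec_closure[/hpt_closureP/(_ j) xw _] vx] :=
    cl _ (divr_gt0 p0 m1).
  have := @fval_bound j v x _ (fun i => ltW (vx i)); rewrite -/m.
  set a := fval A j v - offset A j in p0 *.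
  set b := fval A j x - offset A j in xw *.
  have -> : fval A j v - fval A j x = a - b by rewrite /a /b; ring.
  move=> le; have lt : `|a - b| < `|a|.
    apply: le_lt_trans le _; rewrite -mulrA -[ltRHS]mulr1 ltr_pM2l //.
    by rewrite mulrC ltr_pdivrMr // mul1r ltrDl.
  have ab : 0 < a * b.
    have : (a - b) ^+ 2 < a ^+ 2.
      by rewrite -[ltLHS]real_normK ?num_real // -[ltRHS]real_normK ?num_real // ltrXn2r.
    by nra.
  apply: (mul_gt0_trans ab); case: xw => // E.
  by move: ab; rewrite /b E subrr mulr0 ltxx.
have {}xw := in_closure_trans xv vw.
apply/closure_boxP => e e0.
set m := \sum_i `|w i 0 - x i 0|.
have m0 : 0 <= m by apply: sumr_ge0.
(* With this [b] the weight [a] is below 1 and [a * m < e], so the chosen point of the segment is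
   within [e] of [x]. *)
pose b := 1 + m / e; have b1 : 1 <= b by rewrite lerDl divr_ge0 // ltW.
have b0 : 0 < b by exact: lt_le_trans b1.
pose a := b^-1 / 2; have a0 : 0 < a by rewrite divr_gt0 // invr_gt0.
have a1 : 0 < 1 - a.
  rewrite subr_gt0 /a; have : b^-1 <= 1 by rewrite invf_le1.
  by move=> h; lra.
exists (a *: w + (1 - a) *: x).
  have E : hpt (a *: w + (1 - a) *: x) = a *: hpt w + (1 - a) *: hpt x.
    by congr pair; rewrite /= /GRing.scale /= !mulr1 addrC subrK.
  have c1 : a *: hpt w ⊑ hpt w by apply: in_closure_scale => //;
    exact: hform_lin.
  have c2 : (1 - a) *: hpt x ⊑ hpt w.
    by apply: in_closure_trans xw; apply: in_closure_scale => //;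
      exact: hform_lin.
  apply/sign_vec_closure; rewrite E; split.
    by apply: in_closureD => //; exact: hform_lin.
  apply: in_closure_trans (in_closure_Dl _ c1 c2); last exact: hform_lin.
  by apply: in_closure_unscale => //; exact: hform_lin.
move=> i; rewrite !mxE.
have -> : x i 0 - (a * w i 0 + (1 - a) * x i 0) = - (a * (w i 0 - x i 0)) by ring.
rewrite normrN normrM (gtr0_norm a0).
have le_m : `|w i 0 - x i 0| <= m.
  by rewrite /m (bigD1 i) //= lerDl sumr_ge0.
apply: le_lt_trans (ler_wpM2l (ltW a0) le_m) _.
have : m / e < b by rewrite /b ltrDr.
rewrite ltr_pdivrMr // => mb.
apply: (@lt_le_trans _ _ (a * (b * e))); first by rewrite ltr_pM2l.
have -> : a * (b * e) = e / 2 by rewrite /a; field; rewrite gt_eqF.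
by lra.
Qed.

End Homogenization.
(** * The bounded complex *)

Section BoundedComplex.

Variables (R : realType) (d n : nat) (A : arrangement R d n).
Implicit Types (v w u : 'cV[R]_d).

Local Notation hform := (hform A).
Local Notation "x ⊑ y" := (in_closure hform x y) (at level 70).
Local Notation ray_over := (ray_over hform).

Let h_lin := hform_lin A.
Let le_trans' := @in_closure_trans R (hspace R d) (option 'I_n) hform.
Let le_refl' := in_closure_refl hform.

Definition hbounded (x : hspace R d) : Prop :=
  forall y, y ⊑ x -> 0 < hform None y \/ y ⊑ 0.

Lemma hbounded_closed x y : hbounded x -> y ⊑ x -> hbounded y.
Proof. by move=> bx yx z zy; apply: bx; exact: le_trans' yx. Qed.

Lemma hform_span0 x i : in_span hform 0 x -> hform i x = 0.
Proof. by move=> h; apply: h; exact: (linform0 (h_lin i)). Qed.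

Lemma ray0_colinear f x : ray_over 0 f -> in_span hform f x ->
  exists a, x = a *: f.
Proof.
move=> ray /ray[a xa]; exists a; apply/eqP; rewrite -subr_eq0; apply/eqP.
by apply: (@hform_essential _ _ _ A) => i; exact: hform_span0.
Qed.

Definition hsign (x : hspace R d) : {ffun option 'I_n -> bool * bool} :=
  [ffun i => (0 < hform i x, hform i x < 0)].

Lemma hsign_closure x y : hsign x = hsign y -> x ⊑ y.
Proof.
move=> /ffunP E i; have := E i; rewrite !ffunE => -[].
case: (ltgtP (hform i x) 0) => [x0 _ y0|x0 y0 _|->]; [| |by left]; right.
  by rewrite nmulr_rgt0 // -y0.
by rewrite mulr_gt0 // -y0.
Qed.

(** If [l - M t], with [t] the form of index [None], were positive somewhere on the closed cone, it
    would be positive on an extremal ray. There are finitely many of these up to scaling, and [M]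
    bounds the ratio of [l] to [t] on each. *)
Lemma hbounded_linform v (l : hspace R d -> R) : scalar l -> hbounded (hpt v) ->
  exists M, forall y, y ⊑ hpt v -> l y <= M * hform None y.
Proof.
move=> ll bv.
pose P s f := [/\ ray_over 0 f, f ⊑ hpt v, ~ f ⊑ 0 & hsign f = s].
(* One representative ray for each sign pattern, and 0 for the patterns without a ray. *)
have /choice[F FP] : forall s, exists f, (exists f', P s f') -> P s f.
  move=> s; have [[f Pf]|no] := pselect (exists f', P s f'); first by exists f.
  by exists 0 => /no.
pose M := \sum_s `|l (F s) / hform None (F s)|; exists M => y yv.
rewrite leNgt; apply/negP => lt.
pose q x := l x - M * hform None x.
have q_lin : scalar q by move=> a x z; rewrite /q ll h_lin; ring.
have q0 : q 0 = 0 by exact: linform0.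
have [|f [f0 fv qf ray]] := exists_ray h_lin q_lin q0 (in_closure0 h_lin _) yv.
  by rewrite subr_gt0.
have nf0 : ~ f ⊑ 0 by move=> /closure0_eq0 E; rewrite E q0 ltxx in qf.
have [|ray' fv' nf0' sf'] := FP (hsign f); first by exists f.
set f' := F (hsign f) in ray' fv' nf0' sf'.
have tf : 0 < hform None f by case: (bv f fv).
have tf' : 0 < hform None f' by case: (bv f' fv').
have [a fE] := ray0_colinear ray (in_closure_span (hsign_closure sf')).
have ratio : l f' / hform None f' = l f / hform None f.
  rewrite fE (linformZ ll) (linformZ (h_lin None)).
  have a0 : a != 0.
    by apply: contraTneq tf' => a0;
      rewrite fE a0 scale0r (linform0 (h_lin None)) ltxx.
  by field; rewrite a0 gt_eqF.
suff : l f / hform None f <= M.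
  by rewrite ler_pdivrMr // -subr_le0 leNgt qf.
rewrite -ratio; apply: le_trans (ler_norm _) _.
by rewrite /M (bigD1 (hsign f)) //= lerDl sumr_ge0.
Qed.

(** A nonzero point of the closed cone at height 0 is a direction in which the cell recedes to
    infinity. Conversely, [hbounded_linform] bounds each coordinate and its negative. *)
Lemma coord_boundedP v : coord_bounded (cell A (sign_vec A v)) <-> hbounded (hpt v).
Proof.
split=> [[M Mb] [u a] yv|bv].
  have := yv None; rewrite /= mulr1 => -[a0|]; last by left.
  right; rewrite {a}a0 in yv *.
  suff -> : u = 0 by exact: le_refl'.
  apply/matrixP => i j; rewrite (ord1 j) [RHS]mxE; apply/eqP/negP => /negP ui.
  (* A step of length [N] along [u] changes coordinate [i] of [v] by [M + |v i 0| + 1] in absolute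
     value, which takes it beyond the bound [M]. *)
  pose N := (M + `|v i 0| + 1) / `|u i 0|.
  have M0 : 0 <= M by apply: le_trans (Mb v erefl i).
  have nu : 0 < `|u i 0| by rewrite normr_gt0.
  have p0 : 0 < M + `|v i 0| + 1 by rewrite ltr_wpDl // addr_ge0.
  have N0 : 0 < N by rewrite divr_gt0.
  have vN : sign_vec A (v + N *: u) = sign_vec A v.
    have E : hpt (v + N *: u) = hpt v + N *: ((u, 0) : hspace R d).
      by congr pair; rewrite /= /GRing.scale /= mulr0 addr0.
    have sv : N *: ((u, 0) : hspace R d) ⊑ hpt v.
      by apply: le_trans' yv; apply: in_closure_scale.
    apply/sign_vec_closure; rewrite E; split.
      by apply: in_closureD.
    exact: in_closure_Dl h_lin _ _ _ (le_refl' _) sv.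
  have := Mb _ vN i; rewrite !mxE leNgt => /negP; apply.
  have E : `|N * u i 0| = M + `|v i 0| + 1.
    by rewrite normrM (gtr0_norm N0) /N divfK // gt_eqF.
  have := ler_normB (v i 0 + N * u i 0) (v i 0); rewrite addrAC subrr add0r E.
  by move=> h; lra.
have /choice[M MP] : forall ib : 'I_d * bool, exists M, forall y, y ⊑ hpt v ->
    (-1) ^+ ib.2 * y.1 ib.1 0 <= M * hform None y.
  move=> [i b]; apply: (hbounded_linform _ bv) => a x y /=.
  by rewrite !mxE; ring.
exists (\sum_ib `|M ib|) => w /sign_vec_closure[wv _] i.
have le (b : bool) : (-1) ^+ b * w i 0 <= \sum_ib `|M ib|.
  have := MP (i, b) (hpt w) wv; rewrite /= mulr1 => h.
  apply: le_trans h _; apply: le_trans (ler_norm _) _.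
  by rewrite (bigD1 (i, b)) //= lerDl sumr_ge0.
rewrite ler_norml; have := le true; have := le false.
rewrite expr0 expr1 mul1r mulN1r => h1 h2; rewrite h1 andbT.
by rewrite lerNl.
Qed.

Lemma cell_pt_sign (s : bounded_cell A) : sign_vec A (cell_pt A (val s)) = val s.
Proof. by have /asboolP[ne _] := valP s; exact: (xgetPex 0 ne). Qed.

Variables (o : bounded_cell A -> seq 'cV[R]_d) (ho : orientation o).

Local Notation B := (bounded_complex o).

Definition hcell (c : acell B) : hspace R d :=
  if c is Some s then hpt (cell_pt A (val s)) else 0.

(** The cone has one dimension more than the cell. Putting the point first makes [inc] agree with
    [incidence], and with the value 1 at the empty cell. *)
Definition hframe (c : acell B) : seq (hspace R d) :=
  if c is Some s then hpt (cell_pt A (val s)) :: map (@hdir R d) (o s) else [::].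

Lemma hpt_nclosure0 v : ~ hpt v ⊑ 0.
Proof.
move=> /closure0_eq0/(congr1 snd)/eqP /=.
by rewrite oner_eq0.
Qed.

Lemma hcell_bounded c : hbounded (hcell c).
Proof.
case: c => [s|] /=; last by right.
apply/coord_boundedP; rewrite cell_pt_sign.
by have /asboolP[] := valP s.
Qed.

Lemma hcell_surj x : hbounded x -> exists c, x ⊑ hcell c /\ hcell c ⊑ x.
Proof.
move=> bx; case: (bx x (le_refl' x)) => [x0|/closure0_eq0 ->]; last first.
  by exists None; split; exact: le_refl'.
have [v [vx xv]] := hpt_scale x0.
have sP : `[< cell A (sign_vec A v) !=set0 /\ coord_bounded (cell A (sign_vec A v)) >].
  apply/asboolP; split; first by exists v.
  by apply/coord_boundedP; exact: hbounded_closed vx.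
pose s : bounded_cell A := exist _ (sign_vec A v) sP.
have /sign_vec_closure[sv vs] := cell_pt_sign s.
by exists (Some s); split; [exact: le_trans' xv vs | exact: le_trans' sv vx].
Qed.

Lemma hcell_inj c c' : hcell c ⊑ hcell c' -> hcell c' ⊑ hcell c -> c = c'.
Proof.
case: c c' => [s|] [s'|] //= h1 h2; last 2 first.
- by case: (hpt_nclosure0 h1).
- by case: (hpt_nclosure0 h2).
congr Some; apply: val_inj; rewrite /= -[LHS]cell_pt_sign -[RHS]cell_pt_sign.
by apply/sign_vec_closure.
Qed.

Lemma aface_hcell c' c : aface c' c = `[< hcell c' ⊑ hcell c >].
Proof.
case: c' c => [s'|] [s|] //=; apply/esym.
- apply/asboolP/asboolP => [/cell_closureP|h]; first by rewrite !cell_pt_sign.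
  by apply/cell_closureP; rewrite !cell_pt_sign.
- by apply/asboolP => /hpt_nclosure0.
- by apply/asboolP; exact: in_closure0.
- by apply/asboolP; exact: le_refl'.
Qed.

Lemma hdir_linear : linear (@hdir R d).
Proof. by move=> a u v; congr pair; rewrite /= /GRing.scale /= mulr0 addr0. Qed.

Definition hdirL : {linear 'cV[R]_d -> hspace R d} :=
  HB.pack (@hdir R d)
    (GRing.isLinear.Build R 'cV[R]_d (hspace R d) _ (@hdir R d) hdir_linear).

Lemma o_basis s : basis_of (flat_dir A (cell_pt A (val s))) (o s).
Proof. by have := ho s; rewrite -[in hull_dir _](cell_pt_sign s) hull_dirE. Qed.

Lemma span_hdir s x : x \in <<map (@hdir R d) (o s)>>%VS <->
  exists2 u, u \in flat_dir A (cell_pt A (val s)) & x = hdir u.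
Proof.
have -> : map (@hdir R d) (o s) = map (linfun hdirL) (o s).
  by apply: eq_map => u; rewrite lfunE.
rewrite -limg_span (span_basis (o_basis s)).
split=> [/memv_imgP[u us ->]|[u us ->]]; first by exists u; rewrite ?lfunE.
by apply/memv_imgP; exists u; rewrite ?lfunE.
Qed.

Lemma hdir_free s : free (map (@hdir R d) (o s)).
Proof.
have -> : map (@hdir R d) (o s) = map (linfun hdirL) (o s).
  by apply: eq_map => u; rewrite lfunE.
apply: basis_free; apply: limg_basis_of (o_basis s).
suff /lker0P/eqP -> : injective (linfun hdirL) by rewrite capv0.
by move=> u v; rewrite !lfunE /= => -[].
Qed.

Lemma hframe_free c : free (hframe c).
Proof.
case: c => [s|]; last exact: nil_free.
rewrite free_cons hdir_free andbT; apply/negP => /span_hdir[u _].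
by move=> /(congr1 snd)/eqP; rewrite /= oner_eq0.
Qed.

Lemma hframe_span c x : x \in <<hframe c>>%VS <-> in_span hform (hcell c) x.
Proof.
case: c => [s|] /=; last first.
  rewrite span_nil memv0; split=> [/eqP -> i _|h]; first exact: linform0.
  by apply/eqP; apply: (@hform_essential _ _ _ A) => i; exact: hform_span0.
set p := cell_pt A (val s); rewrite span_cons; split.
  move=> /memv_addP[_ /vlineP[a ->] [_ /span_hdir[u /flat_dirP up ->] ->]] i p0.
  rewrite (linformD (h_lin i)) (linformZ (h_lin i)) p0 mulr0 add0r.
  case: i p0 => [j|] /= p0; last by move/eqP: p0; rewrite oner_eq0.
  by rewrite mulr0 subr0; apply: up; move: p0; rewrite mulr1 => /subr0_eq.
case: x => u a h.
have -> : (u, a) = a *: hpt p + hdir (u - a *: p) :> hspace R d.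
  by congr pair; rewrite /= ?addr0 /GRing.scale /= ?mulr1 // addrC subrK.
apply: memv_add; first by rewrite memvZ // memv_line.
apply/span_hdir; exists (u - a *: p) => //; apply/flat_dirP => j pj.
have := h (Some j); rewrite hform_hpt pj subrr => /(_ erefl) /= E.
by rewrite addrC -scaleNr fvalP pj mulNr addrC mulrC.
Qed.

Lemma adim_hframe c : adim c = (size (hframe c))%:Z - 1.
Proof.
case: c => [s|] //=; rewrite size_map /cell_dim.
rewrite -(span_basis (ho s)) -size_free ?(basis_free (ho s)) //.
by rewrite intS addrC addKr.
Qed.

Lemma facet_hcell c' c : facet hform hcell hframe c' c =
  aface c' c && (adim c' == adim c - 1).
Proof.
rewrite /facet aface_hcell; congr andb; rewrite !adim_hframe.
by rewrite subr_eq subrK [RHS]eq_sym subr_eq addrC -intS.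
Qed.

Lemma ainc_hcell c c' : facet hform hcell hframe c' c ->
  ainc c c' = inc hcell hframe c c'.
Proof.
move=> /[dup] fc /andP[/asboolP c'c /eqP sz];
  case: c c' fc c'c sz => [s|] [t|] fc c'c sz //.
  rewrite /= /incidence /inc /hframe /hcell.
  set p := cell_pt A (val s); set q := cell_pt A (val t).
  rewrite -[\det _]/(frame_det (o s) (q - p :: o t)); congr sgz.
  have sub : (flat_dir A q <= flat_dir A p)%VS.
    apply/subvP => u /flat_dirP qu; apply/flat_dirP => j pj; apply: qu.
    move/hpt_closureP: c'c => /(_ j)[//|].
    by rewrite -/p pj subrr mulr0 ltxx.
  have ins i : (q - p :: o t)`_i \in flat_dir A p.
    case: i => [|i] /=.
      apply/flat_dirP => j pj; rewrite addrC -scaleN1r fvalP mulN1r pj.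
      move/hpt_closureP: c'c => /(_ j)[->|]; first by rewrite addNr.
      by rewrite -/p pj subrr mulr0 ltxx.
    have [it|it] := ltnP i (size (o t)); last by rewrite nth_default ?mem0v.
    by apply: (subvP sub); rewrite -(span_basis (o_basis t)) memv_span ?mem_nth.
  have ins' i : (q - p :: o t)`_i \in <<o s>>%VS by rewrite (span_basis (o_basis s)).
  have hmap i : (map (@hdir R d) (q - p :: o t))`_i = hdir (q - p :: o t)`_i.
    have [it|it] := ltnP i (size (q - p :: o t)); first exact: (nth_map 0).
    by rewrite !nth_default ?size_map.
  (* [hpt q] is [hpt p] plus the direction [q - p]; removing the multiple of the first row leaves a
     determinant of directions. *)
  rewrite (@frame_det_cons _ _ (hpt p) _ _ (map (@hdir R d) (q - p :: o t))).
  - apply/esym/(@frame_det_map _ _ _ hdirL (o s) (q - p :: o t)) => //.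
    exact: hdir_free.
  - exact: (hframe_free (Some s)).
  - by move=> i _; rewrite hmap; apply/span_hdir; exists (q - p :: o t)`_i.
  - move=> [|i] _ /=; last by exists 0; rewrite scale0r add0r.
    by exists 1; rewrite scale1r; congr pair; rewrite /= ?addr0 // addrC subrK.
(* Here [c'] is the empty cell and [c] a vertex, with the single frame vector [hpt p]. *)
move: sz => /= -[]; rewrite size_map => /eqP; rewrite size_eq0 => /eqP E.
rewrite /inc /= E frame_det_id; first by rewrite gtr0_sgz ?ltr01.
by have := hframe_free (Some s); rewrite /= E.
Qed.

Lemma bd_mx_inc (k : fieldType) (c c' : acell B) :
  bd_mx k c c' = inc_mx hform k hcell hframe c c'.
Proof.
rewrite /bd_mx /inc_mx -facet_hcell.
by case: ifP => // /ainc_hcell ->.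
Qed.

Lemma bounded_square0 (k : fieldType) (c b : acell B) :
  \sum_c' bd_mx k c c' * bd_mx k c' b = 0.
Proof.
rewrite -[RHS](@inc_mx_square0 _ _ _ _ h_lin k _ hcell hframe hbounded hbounded_closed
  hcell_surj hcell_inj hcell_bounded hframe_free hframe_span c b).
by apply: eq_bigr => c' _; rewrite !bd_mx_inc.
Qed.

Lemma bounded_poly_exact (k : fieldType) (Ap Am : {set option 'I_n}) :
  (exists2 c, c \in poly_cells hform hcell Ap Am & ~ hcell c ⊑ 0) ->
  exact_on (@bd_mx k B) (poly_cells hform hcell Ap Am).
Proof.
apply: (poly_exact h_lin hbounded_closed hcell_surj hcell_inj _ _ _
  (h_lin None)) => //.
- exact: bounded_square0.
- move=> c c'; rewrite bd_mx_inc; apply: inc_mx_face => //.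
  + exact: hframe_free.
  + exact: hframe_span.
- move=> c c'; rewrite bd_mx_inc; apply: inc_mx_ray => //.
  + exact: hframe_free.
  + exact: hframe_span.
- by move=> u /hform_span0.
- exact: hcell_bounded.
Qed.

(** The origin is the empty cell, of dimension -1, and a ray is one dimension above it. *)
Lemma ray_vertex f : ray_over 0 f -> ~ f ⊑ 0 -> hbounded f ->
  exists s : bounded_cell A, [/\ cell_dim A (val s) = 0%N,
    f ⊑ hcell (Some s) & hcell (Some s) ⊑ f].
Proof.
move=> ray nf0 bf; have [[s|] [fs sf]] := hcell_surj bf; last by [].
exists s; split=> //.
have : facet hform hcell hframe None (Some s).
  apply: (ray_facet hframe_free hframe_span).
  - exact: in_closure0.
  - exact: hpt_nclosure0.
  - by apply: ray_over_eqv ray => //; exact: in_closure0.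
by rewrite facet_hcell => /andP[_ /eqP /= E]; lia.
Qed.

(** The closed cone of [hpt w] has an extremal ray of positive height, which is bounded even if the
    cell of [w] is not. *)
Lemma vertex_below w : exists s : bounded_cell A,
  cell_dim A (val s) = 0%N /\ hcell (Some s) ⊑ hpt w.
Proof.
have [|f [f0 fw tf ray]] := exists_ray h_lin (h_lin None) (linform0 (h_lin None))
  (in_closure0 h_lin (hpt w)) (le_refl' _); first by rewrite /= ltr01.
have span0 x : in_span hform 0 x -> hform None x = 0 by exact: hform_span0.
have nf0 : ~ f ⊑ 0 by move=> /in_closure_span/span0 E; rewrite E ltxx in tf.
have bf : hbounded f.
  by move=> y yf; exact: (ray_over_closure h_lin (h_lin None) span0 f0 ray tf yf).
have [s [s0 fs sf]] := ray_vertex ray nf0 bf.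
by exists s; split=> //; exact: le_trans' fw.
Qed.

(** An extremal ray of the cone over [s] with [l] positive is bounded because [s] is, hence is a
    vertex. *)
Lemma vertex_positive (s : bounded_cell A) l : scalar l ->
  0 < l (hcell (Some s)) ->
  exists t : bounded_cell A, [/\ cell_dim A (val t) = 0%N,
    hcell (Some t) ⊑ hcell (Some s) & 0 < l (hcell (Some t))].
Proof.
move=> ll ls; have l0 : forall x, in_span hform 0 x -> l x = 0.
  move=> x h; suff -> : x = 0 by exact: linform0.
  by apply: (@hform_essential _ _ _ A) => i; exact: hform_span0.
have [f [f0 fs lf ray]] := exists_ray h_lin ll (linform0 ll)
  (in_closure0 h_lin (hcell (Some s))) (le_refl' _) ls.
have nf0 : ~ f ⊑ 0 by move=> /in_closure_span/l0 E; rewrite E ltxx in lf.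
have [t [t0 ft tf]] := ray_vertex ray nf0 (hbounded_closed (@hcell_bounded (Some s)) fs).
exists t; split=> //; first exact: le_trans' fs.
by case: (ray_over_closure h_lin ll l0 f0 ray lf tf) => // /hpt_nclosure0.
Qed.

End BoundedComplex.
(** * Labellings by sides of hyperplanes *)

Lemma mnm_biglcm (N : nat) (J : finType) (P : pred J) (F : J ->
  'X_{1..N}) (i : 'I_N) :
  (\big[@mlcm N/0%MM]_(v | P v) F v) i = (\max_(v | P v) F v i)%N.
Proof.
by apply: (big_morph (fun m : 'X_{1..N} => m i)) => [m m'|]; rewrite ?mnmE.
Qed.

Section SideLabelling.

Variables (k : fieldType) (R : realType) (d n : nat) (A : arrangement R d n).
Variables (o : bounded_cell A -> seq 'cV[R]_d) (ho : orientation o).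
Implicit Types (v w : 'cV[R]_d).

Local Notation hform := (hform A).
Local Notation "x ⊑ y" := (in_closure hform x y) (at level 70).
Local Notation B := (bounded_complex o).

(* The variable of index [j] records whether a point is on the positive side
   (if [up j]) or on the negative side (if [dn j]) of the hyperplane [idx j]. *)
Variables (N : nat) (L : 'cV[R]_d -> 'X_{1..N}) (idx : 'I_N -> 'I_n).
Variables (up dn : pred 'I_N).
Hypothesis LE : forall v j, L v j =
  ((up j && (offset A (idx j) < fval A (idx j) v)) ||
   (dn j && (fval A (idx j) v < offset A (idx j))) : nat).
Hypothesis up_cover : forall i, exists2 j, idx j = i & up j.
Hypothesis dn_cover : forall i, exists2 j, idx j = i & dn j.

Let lab (s : cx_cell B) : 'X_{1..N} := L (cell_pt A (val s)).
Let I : set {mpoly k[N]} := ideal_gen [set 'X_[L v] | v in [set: 'cV[R]_d]].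

(** Hyperplanes for which a variable recording the side [D] is missing from [m]; points whose label
    divides [m] avoid that side. *)
Definition absent (D : pred 'I_N) (m : 'X_{1..N}) : {set option 'I_n} :=
  [set i | if i is Some i' then [exists j, [&& idx j == i', D j & m j == 0%N]]
           else false].

(** A missing variable for the positive side forces the point onto the closed negative side, and
    vice versa. Divisibility of [m] thus cuts out an intersection of closed half-spaces. *)
Lemma side_le v (m : 'X_{1..N}) :
  (L v <= m)%MM <-> in_poly hform (absent dn m) (absent up m) (hpt v).
Proof.
split=> [/mnm_lepP le [i|]|h]; last 2 first.
- by rewrite !inE.
- apply/mnm_lepP => j; rewrite LE; have [m0|] := posnP (m j); last first.
    by apply: leq_trans; case: (_ || _).
  rewrite m0 leqn0 eqb0 negb_or !negb_and; have := h (Some (idx j)).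
  rewrite !inE hform_hpt => -[hp hm]; apply/andP; split.
    case: (boolP (up j)) => //= uj; rewrite -leNgt -subr_le0; apply: hm.
    by apply/existsP; exists j; rewrite eqxx uj m0.
  case: (boolP (dn j)) => //= dj; rewrite -leNgt -subr_ge0; apply: hp.
  by apply/existsP; exists j; rewrite eqxx dj m0.
rewrite !inE hform_hpt; split=> /existsP[j /and3P[/eqP <- uj /eqP m0]].
  have := le j; rewrite m0 leqn0 LE eqb0 negb_or uj /= => /andP[_].
  by rewrite -leNgt subr_ge0.
have := le j; rewrite m0 leqn0 LE eqb0 negb_or uj /= => /andP[+ _].
by rewrite -leNgt subr_le0.
Qed.

Lemma side_mono v w : hpt v ⊑ hpt w -> (L v <= L w)%MM.
Proof.
move=> vw; apply/side_le; apply: in_poly_closure vw.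
by apply/side_le; exact: lepm_refl.
Qed.

(** No variable of a hyperplane through [w] divides the label of [w], hence none divides that of
    [v]; the two covers then exclude both sides. *)
Lemma side_zero v w i : (L v <= L w)%MM -> fval A i w = offset A i ->
  fval A i v = offset A i.
Proof.
move=> /mnm_lepP le w0.
have [ju uE uj] := up_cover i; have [jd dE dj] := dn_cover i.
have := le ju; have := le jd; rewrite !LE uE dE w0 ltxx !andbF !leqn0 !eqb0.
rewrite !negb_or uj dj /= -!leNgt => /andP[_ h1] /andP[h2 _].
by apply/eqP; rewrite eq_le h1 h2.
Qed.

Lemma side_faithful v w : hpt v ⊑ hpt w -> L v = L w -> hpt w ⊑ hpt v.
Proof.
move=> vw E; apply: (in_closure_common (in_closure_refl _ _) vw) => -[i|].
  rewrite !hform_hpt => /subr0_eq v0; apply/eqP; rewrite subr_eq0; apply/eqP.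
  by apply: (side_zero _ v0); rewrite E lepm_refl.
by move=> /eqP; rewrite /= oner_eq0.
Qed.

(* A nonzero sign on a bounded cell is also taken at one of its vertices. *)
Lemma side_label (s : cx_cell B) : cell_label lab (Some s) = lab s.
Proof.
apply/mnmP => j; rewrite /= mnm_biglcm; apply/eqP; rewrite eqn_leq;
  apply/andP; split.
  apply/bigmax_leqP => t /andP[_ ts]; move: j; apply/mnm_lepP.
  have : aface (Some t : acell B) (Some s : acell B) := ts.
  by rewrite aface_hcell => /asboolP; exact: side_mono.
have above t : cell_dim A (val t) = 0%N -> hcell (o :=
  o) (Some t) ⊑ hcell (o := o) (Some s) ->
    (lab t j <= \max_(t : cx_cell B | (cx_dim t == 0%N) && cx_face t s) lab t j)%N.
  move=> t0 ts; apply: (@leq_bigmax_cond _ _ (fun t => lab t j)).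
  rewrite /= t0 eqxx /=; have : aface (Some t : acell B) (Some s : acell B).
    by rewrite aface_hcell; apply/asboolP.
  by [].
have h_lin := hform_lin A.
rewrite {1}/lab LE; case: (boolP (_ && _)) => /= [/andP[uj js]|_].
  have [|t [t0 ts lt]] := vertex_positive ho (s := s) (h_lin (Some (idx j))).
    by rewrite hform_hpt subr_gt0.
  apply: leq_trans (above t t0 ts); rewrite /lab LE uj.
  by move: lt; rewrite hform_hpt subr_gt0 => ->.
case: (boolP (_ && _)) => /= [/andP[dj js]|_] //.
pose l x := - hform (Some (idx j)) x.
have l_lin : scalar l by move=> a x y; rewrite /l h_lin; ring.
have [|t [t0 ts lt]] := vertex_positive ho (s := s) l_lin.
  by rewrite /l hform_hpt oppr_gt0 subr_lt0.
apply: leq_trans (above t t0 ts); rewrite /lab LE dj.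
by move: lt; rewrite /l hform_hpt oppr_gt0 subr_lt0 => ->; rewrite orbT.
Qed.

Lemma side_label_neq (t s : cx_cell B) : cx_face t s -> t != s ->
  cell_label lab (Some s) <> cell_label lab (Some t).
Proof.
rewrite !side_label => ts ne E; case/eqP: ne.
have : aface (Some t : acell B) (Some s : acell B) := ts;
  rewrite aface_hcell => /asboolP ts'.
have [] // : Some t = Some s :> acell B.
by apply: hcell_inj => //; apply: side_faithful.
Qed.

Lemma side_label_exact m :
  (exists c : cx_cell B, (cell_label lab (Some c) <= m)%MM) ->
  exact_on (@bd_mx k B) (label_cells lab m).
Proof.
move=> [s sm].
(* The cells whose label divides [m] are those of a polyhedron, the empty cell being in both
   sets. *)
have E : label_cells lab m = poly_cells hform (@hcell _ _ _ _ o)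
    (absent dn m) (absent up m).
  apply/setP => -[c|]; rewrite [LHS]inE; apply/idP/poly_cellsP.
  - by rewrite side_label => /side_le.
  - by rewrite side_label => /side_le.
  - by move=> _ i; rewrite (linform0 (hform_lin A i)).
  - by move=> _; apply/mnm_lepP => j; rewrite mnm0E.
rewrite E; apply: bounded_poly_exact => //; exists (Some s);
  last exact: hpt_nclosure0.
by rewrite -E inE.
Qed.

Lemma side_label_mono (c c' : acell B) : aface c' c ->
  (cell_label lab c' <= cell_label lab c)%MM.
Proof.
rewrite aface_hcell => /asboolP; case: c' => [t|]; last first.
  by move=> _; apply/mnm_lepP => j; rewrite mnm0E.
case: c => [s|]; last by move=> /hpt_nclosure0.
by rewrite !side_label; exact: side_mono.
Qed.

Lemma side_idealP p : I p <-> (forall m, p@_m != 0 -> exists v, (L v <= m)%MM).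
Proof.
have -> : I = ideal_gen [set 'X_[w] | w in [set L v | v in [set: 'cV[R]_d]]].
  by rewrite /I image_comp.
split=> [/monomial_idealP h m /h[_ [v _ <-] vm]|h]; first by exists v.
by apply/monomial_idealP => m /h[v vm]; exists (L v) => //; exists v.
Qed.

(** Every cell has a vertex in its closure, and the label of this vertex divides that of the
    cell. *)
Lemma side_ideal_vertex : I = ideal_gen [set 'X_[lab v] | v in @cx_vertex B].
Proof.
have -> : [set 'X_[lab v] | v in @cx_vertex B] =
    [set 'X_[k, w] | w in [set lab v | v in @cx_vertex B]] by rewrite image_comp.
apply/seteqP; split=> p.
  move=> /side_idealP h; apply/monomial_idealP => m /h[v vm].
  have [s [s0 sv]] := vertex_below ho v.
  exists (lab s); first by exists s.
  exact: lepm_trans (side_mono sv) vm.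
move=> /monomial_idealP h; apply/side_idealP => m /h[_ [s _ <-] sm].
by exists (cell_pt A (val s)).
Qed.

(** For minimality: a label dividing that of a vertex [v] belongs to a point on all hyperplanes
    through [v], and these meet only in [v]. *)
Lemma side_minimally_generated :
  minimally_generated I (vertex A) (fun v => 'X_[L v]).
Proof.
have gen (W : set 'cV[R]_d) p : ideal_gen [set 'X_[k, L v] | v in W] p <->
    (forall m, p@_m != 0 -> exists2 v, W v & (L v <= m)%MM).
  have -> : [set 'X_[k, L v] | v in W] = [set 'X_[w] | w in [set L v | v in W]].
    by rewrite image_comp.
  split=> [/monomial_idealP h m /h[_ [v Wv <-] vm]|h]; first by exists v.
  by apply/monomial_idealP => m /h[v Wv vm]; exists (L v) => //; exists v.
split=> [|W WV WI].
  apply/seteqP; split=> p.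
    move=> /side_idealP h; apply/gen => m /h[v vm].
    have [s [s0 sv]] := vertex_below ho v.
    exists (cell_pt A (val s)); first by rewrite /vertex /= cell_pt_sign.
    exact: lepm_trans (side_mono sv) vm.
  by move=> /gen h; apply/side_idealP => m /h[v _ vm]; exists v.
apply/seteqP; split=> // v v0.
have : I 'X_[L v].
  by apply/side_idealP => m; rewrite mcoeffX; have [<-|_] := eqVneq _ m;
    [exists v; exact: lepm_refl | rewrite eqxx].
rewrite -WI => /gen/(_ (L v)); rewrite mcoeffX eqxx oner_eq0 => -[//|w Ww wv].
suff -> : v = w by [].
apply/eqP; rewrite -subr_eq0 -memv0.
have /eqP <- : flat_dir A v == 0%VS by rewrite -dimv_eq0 -hull_dirE; apply/eqP.
apply/flat_dirP => i vi; rewrite addrC -scaleN1r fvalP vi (side_zero wv vi).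
by rewrite mulN1r addNr.
Qed.

Theorem side_labelling :
  [/\ minimally_generated I (vertex A) (fun v => 'X_[L v]),
      is_I_complex lab I & minimal_free_resolution lab I].
Proof.
split; first exact: side_minimally_generated.
- apply: cellular_I_complex.
  + exact: bounded_square0.
  + exact: side_label_mono.
  + exact: side_label_exact.
  + exact: side_label_neq.
  + exact: side_ideal_vertex.
- apply: cellular_resolution.
  + exact: bounded_square0.
  + exact: side_label_mono.
  + exact: side_label_exact.
  + by move=> v _; exact: side_label.
  + exact: side_label_neq.
  + exact: side_ideal_vertex.
Qed.

End SideLabelling.

(** * The matroid and oriented matroid labels *)

Lemma m_xE (R : realType) (d n : nat) (A : arrangement R d n) v (j : 'I_n) :
  m_x A v j = (fval A j v != offset A j).
Proof.
rewrite /m_x mnm_sumE big_mkcond (bigD1 j) //= mnm1E eqxx big1 ?addn0.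
  by case: ifP.
by move=> i ij; case: ifP => // _; rewrite mnm1E (negbTE ij).
Qed.

Lemma m_xyE (R : realType) (d n : nat) (A : arrangement R d n) v (j : 'I_(n + n)) :
  m_xy A v j = match split j with
    | inl i => offset A i < fval A i v
    | inr i => fval A i v < offset A i
    end.
Proof.
rewrite /m_xy mnmDE !mnm_sumE big_mkcond [X in (_ + X)%N]big_mkcond /=.
case: (splitP j) => i ji.
  have -> : j = lshift n i by apply: val_inj.
  rewrite [X in (_ + X)%N]big1 ?addn0 => [|i' _]; last first.
    by case: ifP => // _; rewrite mnm1E eq_rlshift.
  rewrite (bigD1 i) //= mnm1E eqxx big1 ?addn0; first by case: ifP.
  by move=> i' ne; case: ifP => // _; rewrite mnm1E eq_lshift (negbTE ne).
have -> : j = rshift n i by apply: val_inj.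
rewrite [X in (X + _)%N]big1 ?add0n => [|i' _]; last first.
  by case: ifP => // _; rewrite mnm1E eq_lrshift.
rewrite (bigD1 i) //= mnm1E eqxx big1 ?addn0; first by case: ifP.
by move=> i' ne; case: ifP => // _; rewrite mnm1E eq_rshift (negbTE ne).
Qed.

Theorem theorem1p3 (k : fieldType) (R : realType) (d n : nat)
    (A : arrangement R d n) (o : bounded_cell A -> seq 'cV[R]_d)
    (ho : orientation o) :
  let B : cell_complex := bounded_complex o in
  let lab_x : cx_cell B -> 'X_{1..n} :=
    fun s => m_x A (cell_pt A (val s)) in
  let lab_xy : cx_cell B -> 'X_{1..n + n} :=
    fun s => m_xy A (cell_pt A (val s)) in
  [/\ minimally_generated (matroid_ideal k A) (vertex A)
        (fun v => 'X_[m_x A v]),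
      is_I_complex lab_x (matroid_ideal k A)
    & minimal_free_resolution lab_x (matroid_ideal k A)] /\
  [/\ minimally_generated (oriented_matroid_ideal k A) (vertex A)
        (fun v => 'X_[m_xy A v]),
      is_I_complex lab_xy (oriented_matroid_ideal k A)
    & minimal_free_resolution lab_xy (oriented_matroid_ideal k A)].
Proof.
split.
  (* Each variable records both sides of its hyperplane. *)
  apply: (@side_labelling k R d n A o ho n (m_x A) id predT predT) => //.
  - by move=> v j; rewrite m_xE neq_lt orbC.
  - by move=> i; exists i.
  - by move=> i; exists i.
(* The first block of variables records the positive sides, the second the negative ones. *)
pose idx (j : 'I_(n + n)) := match split j with inl i => i | inr i => i end.
pose is_x (j : 'I_(n + n)) := if split j is inl _ then true else false.
apply: (@side_labelling k R d n A o ho (n + n) (m_xy A) idx is_x (predC is_x)) => //.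
- move=> v j; rewrite m_xyE /idx /is_x /=.
  by case: (split j) => i /=; rewrite ?orbF.
- move=> i; exists (lshift n i); first by rewrite /idx (unsplitK (inl i)).
  by rewrite /is_x (unsplitK (inl i)).
- move=> i; exists (rshift n i); first by rewrite /idx (unsplitK (inr i)).
  by rewrite /= /is_x (unsplitK (inr i)).
Qed.
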